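(* For any $k\le\frac n2$ let $T\in\mathbf{Tab}_{(n-k,k)}$ and let $\sigma_T=(i_1,b_1)\cdots(i_k,b_k)$. Then for any $s\le k$ such that $b_s>2s$, $\mathrm{Change}(T,i_s,b_s)$ is a Young tableau and $$\operatorname{codim}_{\mathcal V_T}\bigl(\mathcal V_T\cap\mathcal V_{\mathrm{Change}(T,i_s,b_s)}\bigr)=1.$$
   Context: Work over $\mathbb C$. $\mathbf{Tab}_{(n-k,k)}$ is the set of Young tableaux with entries $1,\dots,n$ (each used once, increasing along rows and down columns) with two columns, the first of length $n-k$ and the second of length $k$. For such $T$, $\langle T_1\rangle$ and $\langle T_2\rangle$ are the sets of entries of its first and second column; write $\langle T_2\rangle=\{b_1<\dots<b_k\}$. Define the involution $\sigma_T=(i_1,b_1)\cdots(i_k,b_k)$, where $i_1=b_1-1$ and, for $s>1$, $i_s=\max\{d\in\langle T_1\rangle\setminus\{i_1,\dots,i_{s-1}\}: d<b_s\}$. For $i\in\langle T_1\rangle$, $j\in\langle T_2\rangle$, $\mathrm{Change}(T,i,j)$ is the two-column array, with entries increasing down each column, whose first column has entry set $\{j\}\cup\langle T_1\rangle\setminus\{i\}$ and whose second column has entry set $\{i\}\cup\langle T_2\rangle\setminus\{j\}$ (it need not be a Young tableau in general). Orbital varieties: let $\mathfrak n$ be the space of strictly upper-triangular $n\times n$ matrices and $\mathcal O_{(n-k,k)}$ the $GL_n$-conjugacy class of matrices $x$ with $x^2=0$ and rank $k$. The orbital varieties associated to $\mathcal O_{(n-k,k)}$ are the irreducible components of $\mathcal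 O_{(n-k,k)}\cap\mathfrak n$; they are in bijection with $\mathbf{Tab}_{(n-k,k)}$, the component $\mathcal V_T$ being the closure in $\mathcal O_{(n-k,k)}\cap\mathfrak n$ of the set of $x\in\mathcal O_{(n-k,k)}\cap\mathfrak n$ such that for every $m$ the upper-left $m\times m$ block of $x$ has rank $\#\{b\in\langle T_2\rangle: b\le m\}$. Equivalently (known), $\mathcal V_T=\overline{\mathcal B}_{\sigma_T}\cap\mathcal O_{(n-k,k)}$, where $\mathcal B_{\sigma}$ is the orbit, under conjugation by invertible upper-triangular matrices, of the matrix $N_\sigma$ with $(N_\sigma)_{i,j}=1$ if $i<j$ and $\sigma(i)=j$, and $0$ otherwise, and the bar denotes Zariski closure. $\operatorname{codim}_{\mathcal V_T}(Y)=\dim\mathcal V_T-\dim Y$. *)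

(* Defs.v *)
From HB Require Import structures.
From mathcomp Require Import all_boot all_order all_algebra.
From mathcomp Require Import classical_sets reals complex mpoly.

Set Implicit Arguments.
Unset Strict Implicit.
Unset Printing Implicit Defensive.
Import GRing.Theory Num.Theory.
Local Open Scope classical_set_scope.
Local Open Scope ring_scope.

(* An array with two columns, each listed from top to bottom. *)
Definition two_column := (seq nat * seq nat)%type.

(* Row r has a cell in the second column exactly when r < k. *)
Definition young_tableau (n k : nat) (T : two_column) : bool :=
  [&& (k <= n - k)%N, size T.1 == (n - k)%N, size T.2 == k,
      perm_eq (T.1 ++ T.2) (iota 1 n),
      sorted ltn T.1, sorted ltn T.2
    & all (fun r => nth 0 T.1 r < nth 0 T.2 r)%N (iota 0 k)].

(* Each b in bs is paired with the largest smaller element of A not used so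
   far; this \max is over a nonempty set whenever A and bs come from the
   columns of a Young tableau. *)
Fixpoint greedy_pairs (A bs : seq nat) : seq (nat * nat) :=
  if bs is b :: bs' then
    let i := (\max_(d <- A | d < b) d)%N in
    (i, b) :: greedy_pairs (rem i A) bs'
  else [::].

(* The list [:: (i_1, b_1); ...; (i_k, b_k)] of the 2-cycles of sigma_T. *)
Definition sigma_cycles (T : two_column) : seq (nat * nat) :=
  if T.2 is b :: bs then
    (b.-1, b) :: greedy_pairs (rem b.-1 T.1) bs
  else [::].

Definition Change (T : two_column) (i j : nat) : two_column :=
  (sort leq (j :: rem i T.1), sort leq (i :: rem j T.2)).

Section Zariski.
Context {F : fieldType} {n : nat}.
Implicit Types (A B X Y Z : set 'M[F]_n).

(* Polynomials in the n * n matrix entries, which mxvec lists in a row. *)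
Definition zeros (S : set {mpoly F[n * n]}) : set 'M[F]_n :=
  [set x | forall p, S p -> p.@[fun i => mxvec x 0 i] = 0].

Definition zariski_closed A := exists S, A = zeros S.

Definition zariski_closure A : set 'M[F]_n := smallest zariski_closed A.

(* Below, every subset of 'M[F]_n carries the topology induced by the Zariski
   topology; has_dim Y d says that Y has Krull dimension d, which is then
   finite, with Y nonempty. *)
Definition closed_in Y Z := exists2 A, zariski_closed A & Z = Y `&` A.

Definition irreducible Z :=
  Z !=set0 /\
  forall A B, zariski_closed A -> zariski_closed B ->
    Z `<=` A `|` B -> Z `<=` A \/ Z `<=` B.

(* Only C 0, ..., C d matter: d counts the strict inclusions. *)
Definition irreducible_chain Y (d : nat) (C : nat -> set 'M[F]_n) :=
  (forall i, (i <= d)%N -> closed_in Y (C i) /\ irreducible (C i)) /\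
  (forall i, (i < d)%N -> C i `<` C i.+1).

Definition has_dim Y (d : nat) :=
  (exists C, irreducible_chain Y d C) /\
  (forall e C, irreducible_chain Y e C -> (e <= d)%N).

Definition has_codim X Y (c : int) :=
  exists dX dY : nat, [/\ has_dim X dX, has_dim Y dY & c = dX%:Z - dY%:Z].

End Zariski.

Section OrbitalVarieties.
Variables (F : fieldType) (n k : nat).

Definition strictly_upper : set 'M[F]_n :=
  [set x | forall i j : 'I_n, (j <= i)%N -> x i j = 0].

(* The GL_n-conjugacy class O_(n-k,k). *)
Definition square_zero_orbit : set 'M[F]_n :=
  [set x | x *m x = 0 /\ \rank x = k].

Definition upper_left (m : nat) (le_mn : (m <= n)%N) (x : 'M[F]_n) : 'M[F]_m :=
  mxsub (widen_ord le_mn) (widen_ord le_mn) x.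

(* Entries of T are numbered from 1, so the rows and columns of index < m in
   'I_n are those numbered 1, ..., m. *)
Definition generic_part (T : two_column) : set 'M[F]_n :=
  [set x | (square_zero_orbit `&` strictly_upper) x /\
     forall m (le_mn : (m <= n)%N),
       \rank (upper_left le_mn x) = count (fun b => b <= m)%N T.2].

Definition orbital_variety (T : two_column) : set 'M[F]_n :=
  zariski_closure (generic_part T) `&` (square_zero_orbit `&` strictly_upper).

End OrbitalVarieties.

Arguments strictly_upper : clear implicits.
Arguments square_zero_orbit : clear implicits.
Arguments generic_part : clear implicits.
Arguments orbital_variety : clear implicits.

(* Main.v *)
Require Import Defs.
From HB Require Import structures.
From mathcomp Require Import all_boot all_order all_algebra.
From mathcomp Require Import perm boolp classical_sets reals complex mpoly.
From mathcomp Require Import zify ring.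

Set Implicit Arguments.
Unset Strict Implicit.
Unset Printing Implicit Defensive.
Import GRing.Theory Num.Theory.
Local Open Scope classical_set_scope.
Local Open Scope ring_scope.

(* Write u for the positions of the first column of T and b for those of the
   second one.  For x in the generic part of V_T the columns b_1, ..., b_k are a
   basis of the column space, and reducing the other columns by them gives, in
   the basis (u, b),
     x = [M L, M; - L M L, - L M],
   where M m s is supported on u_m < b_s, L s m on b_s < u_m, and rank M = k.
   Conversely every such (L, M) gives a point of the generic part, so the n - k
   by k matrix A = M + L^T consists of independent coordinates: V_T is
   irreducible of dimension k (n - k).

   Let J be the arcs of sigma_T inside [i_s, b_s].  The minor of M on J vanishes
   on V_T', but not on V_T, so the intersection has smaller dimension.  On the
   hypersurface of V_T where this minor vanishes, the column b_s is, in the rows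
   between i_s and b_s, a combination of the columns of the smaller arcs; hence
   there are zeta and eta such that x_t = x(L + t zeta eta, M) stays strictly
   upper triangular while for t <> 0 its pivot b_s moves to i_s.  Thus x_t lies
   in the generic part of V_T' and x_0 = x lies in V_T'.  The coefficients of the
   combination replace all the entries of that column in the rows of J, so
   k (n - k) - 1 free parameters remain.

   Krull dimensions are bounded above by counting monomials in functions that
   separate the members of a chain, and below by switching on the parameters one
   at a time. *)

(** * Polynomial functions and Zariski closures *)

(** Two instances matter: polynomial functions on matrices, and polynomials in one variable along a
    line or curve. A single composition lemma serves both. *)
Definition function_algebra (F : fieldType) (D : Type)
    (C : (D -> F) -> Prop) :=
  [/\ forall c, C (fun=> c),
      forall f g, C f -> C g -> C (fun x => f x + g x)
    & forall f g, C f -> C g -> C (fun x => f x * g x)].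

Section FunctionAlgebra.
Variables (F : fieldType) (D : Type) (C : (D -> F) -> Prop).
Hypothesis algC : function_algebra C.

Lemma alg_cst c : C (fun=> c). Proof. by case: algC. Qed.

Lemma algD f g : C f -> C g -> C (fun x => f x + g x).
Proof. by case: algC => _ + _; apply. Qed.

Lemma algM f g : C f -> C g -> C (fun x => f x * g x).
Proof. by case: algC => _ _; apply. Qed.

Lemma algN f : C f -> C (fun x => - f x).
Proof.
move=> Cf; have -> : (fun x => - f x) = (fun x => (-1) * f x).
  by apply: funext => x; rewrite mulN1r.
exact/algM/Cf/alg_cst.
Qed.

Lemma alg_sum I (r : seq I) (f : I -> D -> F) :
  (forall i, C (f i)) -> C (fun x => \sum_(i <- r) f i x).
Proof.
move=> Cf; elim: r => [|i r IH].
  have -> : (fun x => \sum_(i <- [::]) f i x) = fun=> 0.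
    by apply: funext => x; rewrite big_nil.
  exact: alg_cst.
have -> : (fun x => \sum_(i <- i :: r) f i x)
          = fun x => f i x + \sum_(i <- r) f i x.
  by apply: funext => x; rewrite big_cons.
exact: algD.
Qed.

Lemma alg_prod I (r : seq I) (f : I -> D -> F) :
  (forall i, C (f i)) -> C (fun x => \prod_(i <- r) f i x).
Proof.
move=> Cf; elim: r => [|i r IH].
  have -> : (fun x => \prod_(i <- [::]) f i x) = fun=> 1.
    by apply: funext => x; rewrite big_nil.
  exact: alg_cst.
have -> : (fun x => \prod_(i <- i :: r) f i x)
          = fun x => f i x * \prod_(i <- r) f i x.
  by apply: funext => x; rewrite big_cons.
exact: algM.
Qed.

Lemma algX f m : C f -> C (fun x => f x ^+ m).
Proof.
move=> Cf; have -> : (fun x => f x ^+ m) = fun x => \prod_(i < m) f x.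
  by apply: funext => x; rewrite prodr_const card_ord.
exact: alg_prod.
Qed.

Definition alg_mx p q (A : D -> 'M[F]_(p, q)) :=
  forall i j, C (fun x => A x i j).

Lemma alg_mx_cst p q (A : 'M[F]_(p, q)) : alg_mx (fun=> A).
Proof. by move=> i j; apply: alg_cst. Qed.

Lemma alg_mxD p q (A B : D -> 'M[F]_(p, q)) :
  alg_mx A -> alg_mx B -> alg_mx (fun x => A x + B x).
Proof.
move=> CA CB i j.
have -> : (fun x => (A x + B x) i j) = fun x => A x i j + B x i j.
  by apply: funext => x; rewrite mxE.
exact: algD.
Qed.

Lemma alg_mxN p q (A : D -> 'M[F]_(p, q)) :
  alg_mx A -> alg_mx (fun x => - A x).
Proof.
move=> CA i j; have -> : (fun x => (- A x) i j) = fun x => - A x i j.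
  by apply: funext => x; rewrite mxE.
exact: algN.
Qed.

Lemma alg_mxM p q r (A : D -> 'M[F]_(p, q)) (B : D -> 'M[F]_(q, r)) :
  alg_mx A -> alg_mx B -> alg_mx (fun x => A x *m B x).
Proof.
move=> CA CB i j.
have -> : (fun x => (A x *m B x) i j) = fun x => \sum_l A x i l * B x l j.
  by apply: funext => x; rewrite mxE.
by apply: alg_sum => l; apply: algM.
Qed.

Lemma alg_det m (A : D -> 'M[F]_m) : alg_mx A -> C (fun x => \det (A x)).
Proof.
move=> CA; rewrite /determinant; apply: alg_sum => s; apply: algM.
  exact: alg_cst.
by apply: alg_prod => i; apply: CA.
Qed.

End FunctionAlgebra.

Section PolynomialFunctions.
Variable F : fieldType.

Definition polyfun p q (f : 'M[F]_(p, q) -> F) :=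
  exists P : {mpoly F[p * q]}, forall x, f x = P.@[fun i => mxvec x 0 i].

Lemma polyfun_algebra p q : function_algebra (@polyfun p q).
Proof.
split=> [c|f g [P fP] [Q gQ]|f g [P fP] [Q gQ]].
- by exists c%:MP => x; rewrite mevalC.
- by exists (P + Q) => x; rewrite mevalD fP gQ.
- by exists (P * Q) => x; rewrite mevalM fP gQ.
Qed.

Lemma polyfun_coord p q (i : 'I_p) (j : 'I_q) : polyfun (fun x => x i j).
Proof. by exists 'X_(mxvec_index i j) => x; rewrite mevalXU mxvecE. Qed.

Definition horner_fun (f : F -> F) :=
  exists P : {poly F}, forall t, f t = P.[t].

Lemma horner_algebra : function_algebra horner_fun.
Proof.
split=> [c|f g [P fP] [Q gQ]|f g [P fP] [Q gQ]].
- by exists c%:P => t; rewrite hornerC.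
- by exists (P + Q) => t; rewrite hornerD fP gQ.
- by exists (P * Q) => t; rewrite hornerM fP gQ.
Qed.

Lemma horner_fun_id : horner_fun id.
Proof. by exists 'X => t; rewrite hornerX. Qed.

Lemma polyfun_comp D (C : (D -> F) -> Prop) p q f
    (g : D -> 'M[F]_(p, q)) :
  function_algebra C -> polyfun f -> alg_mx C g -> C (fun x => f (g x)).
Proof.
move=> algC [P fP] Cg.
have -> : (fun x => f (g x)) =
    fun x => \sum_(m <- msupp P) P@_m * \prod_i mxvec (g x) 0 i ^+ m i.
  by apply: funext => x; rewrite fP mevalE.
apply: (alg_sum algC) => m; apply: (algM algC); first exact: alg_cst.
apply: (alg_prod algC) => l; apply: (algX algC).
case/mxvec_indexP: l => i j.
have -> : (fun x => mxvec (g x) 0 (mxvec_index i j)) = fun x => g x i j.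
  by apply: funext => x; rewrite mxvecE.
exact: Cg.
Qed.

End PolynomialFunctions.

Section ZariskiClosure.
Variables (F : fieldType) (n : nat).
Implicit Types (A B Y Z : set 'M[F]_n).

Lemma zeros_closed (S : set {mpoly F[n * n]}) : zariski_closed (zeros S).
Proof. by exists S. Qed.

Lemma zariski_closureP A x :
  zariski_closure A x <->
  forall f, polyfun f -> (forall y, A y -> f y = 0) -> f x = 0.
Proof.
split=> [Ax f [P fP] f0|Ax B [[S ->] AB] P SP].
  have := Ax (zeros [set P]); rewrite fP; apply => //; split.
    exact: zeros_closed.
  by move=> y Ay _ ->; rewrite -fP f0.
apply: (Ax (fun x => P.@[fun i => mxvec x 0 i])); first by exists P.
by move=> y /AB; apply.
Qed.

Lemma zariski_closure_closed A : zariski_closed (zariski_closure A).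
Proof.
exists [set P | forall y, A y -> P.@[fun i => mxvec y 0 i] = 0].
apply/seteqP; split=> x.
  by move=> /zariski_closureP Ax P PA; apply: (Ax _ _ PA); exists P.
move=> Ax; apply/zariski_closureP => f [P fP] f0; rewrite fP; apply: Ax.
by move=> y /f0; rewrite fP.
Qed.

Lemma sub_zariski_closure A : A `<=` zariski_closure A.
Proof. exact: sub_gen_smallest. Qed.

Lemma zariski_closure_min A B :
  zariski_closed B -> A `<=` B -> zariski_closure A `<=` B.
Proof. exact: smallest_sub. Qed.

Lemma zariski_closedI A B :
  zariski_closed A -> zariski_closed B -> zariski_closed (A `&` B).
Proof.
move=> [S ->] [S' ->]; exists (S `|` S'); apply/seteqP; split=> x.
  by move=> [xS xS'] P [/xS|/xS'].
by move=> xSS'; split=> P SP; apply: xSS'; [left|right].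
Qed.

(** The zero sets of [f] and [g] are closed and cover [Z], so one of them contains it: the vanishing
    ideal of an irreducible set is prime. *)
Lemma irreducible_mul Z f g :
  irreducible Z -> polyfun f -> polyfun g ->
  (forall x, Z x -> f x * g x = 0) ->
  (forall x, Z x -> f x = 0) \/ (forall x, Z x -> g x = 0).
Proof.
move=> [_ irrZ] [P fP] [Q gQ] fg0.
have [//|ZP|ZQ] := irrZ _ _ (zeros_closed [set P]) (zeros_closed [set Q]).
- move=> x /fg0 /eqP; rewrite mulf_eq0 => /orP[] /eqP e; [left|right].
    by move=> _ ->; rewrite -fP.
  by move=> _ ->; rewrite -gQ.
- by left=> x /ZP /(_ P erefl); rewrite fP.
- by right=> x /ZQ /(_ Q erefl); rewrite gQ.
Qed.

(** A point of [C j.+1] outside [C j] still lies in [Y], hence violates one of the equations cutting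
    [C j] out of [Y]. *)
Lemma chain_separation Y e C (j : nat) :
  irreducible_chain Y e C -> (j < e)%N ->
  exists P : {mpoly F[n * n]},
    (forall x, C j x -> P.@[fun i => mxvec x 0 i] = 0) /\
    exists2 x, C j.+1 x & P.@[fun i => mxvec x 0 i] != 0.
Proof.
move=> [Cclosed Cincr] lt_je.
have [/Cclosed[[A [S ->] eqC] _] /Cclosed[[B _ eqC'] _]] :
  (j <= e)%N /\ (j.+1 <= e)%N by split; first exact: ltnW.
have [_ /existsNP[x /not_implyP[C'x nCx]]] := Cincr _ lt_je.
have : ~ zeros S x by move=> Sx; apply: nCx; rewrite eqC; split=> //;
  move: C'x; rewrite eqC' => -[].
move=> /existsNP[P /not_implyP[SP /eqP Px]]; exists P; split.
  by move=> y; rewrite eqC => -[_]; apply.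
by exists x.
Qed.

End ZariskiClosure.

Section InfiniteField.
Variable F : numFieldType.

(** In characteristic zero the integers 1, ..., [size P] are distinct and nonzero, and there are
    more of them than [P] has roots. *)
Lemma poly_nonroot (P : {poly F}) : P != 0 -> exists2 t, t != 0 & P.[t] != 0.
Proof.
move=> P0; pose s : seq F := [seq i.+1%:R | i <- iota 0 (size P)].
have Us : uniq s.
  by rewrite map_inj_uniq ?iota_uniq // => i j /eqP; rewrite eqr_nat => /eqP[].
have /allPn[t /mapP[i _ ->] nrt] : ~~ all (root P) s.
  apply/negP => /(max_poly_roots P0) /(_ Us).
  by rewrite size_map size_iota ltnn.
by exists i.+1%:R; rewrite // pnatr_eq0.
Qed.

Lemma horner_fun_nonzero (f : F -> F) s :
  horner_fun f -> f s != 0 -> exists2 t, t != 0 & f t != 0.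
Proof.
move=> [P fP]; rewrite fP => Ps.
have [|t t0 Pt] := @poly_nonroot P; last by exists t => //; rewrite fP.
by apply: contraNneq Ps => ->; rewrite horner0.
Qed.

Lemma horner_fun_line p q (x y : 'M[F]_(p, q)) :
  alg_mx (@horner_fun F) (fun t => x + t *: y).
Proof.
move=> i j; have -> : (fun t => (x + t *: y) i j) = fun t => x i j + t * y i j.
  by apply: funext => t; rewrite !mxE.
have H := horner_algebra F; apply: (algD H); first exact: alg_cst.
by apply: (algM H); [exact: horner_fun_id|exact: alg_cst].
Qed.

(** On the line through [x] and [y] both functions become nonzero polynomials in one variable, and
    so does their product. *)
Lemma polyfun_mul_nonzero p q (f g : 'M[F]_(p, q) -> F) x y :
  polyfun f -> polyfun g -> f x != 0 -> g y != 0 ->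
  exists z, f z * g z != 0.
Proof.
move=> pf pg fx gy; pose z t := x + t *: (y - x).
have [P fP] := polyfun_comp (horner_algebra F) pf (horner_fun_line x (y - x)).
have [Q gQ] := polyfun_comp (horner_algebra F) pg (horner_fun_line x (y - x)).
have [|t _ PQt] := @poly_nonroot (P * Q).
  rewrite mulf_neq0 //.
    by apply: contraNneq fx => P0; have := fP 0;
      rewrite P0 scale0r addr0 horner0 => ->.
  apply: contraNneq gy => Q0.
  by have := gQ 1; rewrite Q0 scale1r addrC subrK horner0 => ->.
by exists (z t); rewrite /z fP gQ -hornerM.
Qed.

(** A polynomial vanishing on [G] restricts to a polynomial in [t] with every [t != 0] as a root, so
    it vanishes at 0 as well. *)
Lemma curve_closure n (G : set 'M[F]_n) (x : F -> 'M[F]_n) :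
  alg_mx (@horner_fun F) x -> (forall t, t != 0 -> G (x t)) ->
  zariski_closure G (x 0).
Proof.
move=> px Gx; apply/zariski_closureP => f pf f0; apply/eqP/negPn/negP => fx.
have [t t0 /eqP[]] := horner_fun_nonzero (polyfun_comp (horner_algebra F) pf px) fx.
exact/f0/Gx.
Qed.

(** By density an equation that fails somewhere on the set already fails on the image. The pullbacks
    of two such equations and [d] have a common point of nonvanishing, whose image lies on neither
    closed set. *)
Lemma irreducible_image p q n (phi : 'M[F]_(p, q) -> 'M[F]_n)
    (d : 'M[F]_(p, q) -> F) a (Z : set 'M[F]_n) :
  alg_mx (@polyfun F p q) phi -> polyfun d -> d a != 0 ->
  (forall x, d x != 0 -> Z (phi x)) ->
  irreducible (zariski_closure [set phi x | x in [set x | d x != 0]] `&` Z).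
Proof.
move=> pphi pd da Zphi; set I := [set phi x | x in _].
have in_set x : d x != 0 -> (zariski_closure I `&` Z) (phi x).
  by move=> dx; split; [apply: sub_zariski_closure; exists x|exact: Zphi].
split; first by exists (phi a); apply: in_set.
move=> A B [S ->] [S' ->] sub; apply/or_asboolP/negPn/negP.
rewrite negb_or => /andP[/asboolPn nA /asboolPn nB].
have sep S0 : ~ (zariski_closure I `&` Z `<=` zeros S0) -> exists P x,
    [/\ S0 P, d x != 0 & P.@[fun i => mxvec (phi x) 0 i] != 0].
  move=> nS; apply: contrapT => H; apply: nS => y [Iy _] P SP.
  move/zariski_closureP: Iy => /(_ (fun y => P.@[fun i => mxvec y 0 i])).
  apply; first by exists P.
  move=> _ [x /= dx <-]; apply/eqP/negPn/negP => Px; apply: H.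
  by exists P, x.
have [P [x [SP dx Px]]] := sep _ nA; have [Q [y [SQ dy Qy]]] := sep _ nB.
have polyP (P0 : {mpoly F[n * n]}) :
    polyfun (fun x => P0.@[fun i => mxvec (phi x) 0 i]).
  apply: (@polyfun_comp F _ (@polyfun F p q) n n
    (fun y => P0.@[fun i => mxvec y 0 i])) => //; last by exists P0.
  exact: polyfun_algebra.
have algP := polyfun_algebra F p q.
have [z] := polyfun_mul_nonzero (algM algP pd (polyP P)) (polyP Q)
  (mulf_neq0 dx Px) Qy.
rewrite !mulf_eq0 !negb_or -andbA => /and3P[dz /eqP Pz /eqP Qz].
by have [/(_ P SP)|/(_ Q SQ)] := sub _ (in_set z dz).
Qed.

End InfiniteField.

(** * Lengths of chains of irreducible sets *)

Section KrullUpperBound.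
Variables (F : fieldType) (n : nat).
Implicit Types (P : {mpoly F[n * n]}).

Let ev P (x : 'M[F]_n) : F := P.@[fun i => mxvec x 0 i].

(* Monomials in functions separating the members of a chain are linearly
   independent: a relation on C j.+1 can be divided by powers of g j, which
   does not vanish there, until it has a nontrivial restriction to C j, where
   g j = 0. *)
Lemma chain_monomials_free (Y : set 'M[F]_n) e C (g : 'I_e -> {mpoly F[n * n]})
    N (c : {ffun 'I_e -> 'I_N} -> F) :
  irreducible_chain Y e C ->
  (forall j : 'I_e, (forall x, C j x -> ev (g j) x = 0) /\
    exists2 x, C j.+1 x & ev (g j) x != 0) ->
  (forall x, C e x ->
    ev (\sum_a c a *: \prod_l g l ^+ a l) x = 0) ->
  forall a, c a = 0.
Proof.
move=> chC gP.
pose same j (b a : {ffun 'I_e -> 'I_N}) :=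
  [forall l : 'I_e, (j <= l)%N ==> (a l == b l)].
have evE (A : pred {ffun 'I_e -> 'I_N}) f x :
    ev (\sum_(a | A a) c a *: f a) x = \sum_(a | A a) c a * ev (f a) x.
  by rewrite /ev rmorph_sum; apply: eq_bigr => a _ /=; rewrite mevalZ.
(* The induction concerns relations on [C j] whose exponents from index [j] on are fixed by [b], so
   that only the [g l] with [l < j] remain as factors. For [j = e] this is the full relation; for
   [j = 0] it has a single term. *)
suff claim j : (j <= e)%N -> forall b,
    (forall x, C j x -> ev (\sum_(a | same j b a) c a *:
       \prod_(l < e | (l < j)%N) g l ^+ a l) x = 0) ->
    forall a, same j b a -> c a = 0.
  move=> c0 a; apply: (claim e (leqnn e) a); last first.
    by apply/forallP => l; rewrite leqNgt ltn_ord.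
  move=> x /c0; congr (ev _ _ = 0).
  apply: eq_big => [b|b _]; last first.
    by congr (_ *: _); apply: eq_bigl => l; rewrite ltn_ord.
  by apply/esym/forallP => l; rewrite leqNgt ltn_ord.
elim: j => [_ b|j IHj lt_je b c0].
  have [[x C0x] _] : irreducible (C 0) by have [/(_ 0 (leq0n e))[]] := chC.
  move=> /(_ x C0x); rewrite (big_pred1 b); last first.
    move=> a; apply/idP/idP => [/forallP ab|/eqP -> /=]; last first.
    by apply/forallP => l; rewrite eqxx.
  apply/eqP.
  by apply/ffunP => l; apply/eqP; have := ab l.
  rewrite big_pred0 // /ev mevalZ meval1 mulr1 => cb a /forallP ab.
  suff -> : a = b by [].
  by apply/ffunP => l; apply/eqP; have := ab l.
pose jo := Ordinal lt_je.
suff H v a : same j.+1 b a -> (a jo < v)%N -> c a = 0.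
  by move=> a ab; apply: (H _ _ ab (ltnSn _)).
elim: v a => // v IHv a ab; rewrite ltnS leq_eqVlt => /orP[/eqP av|];
  last exact: IHv.
have [gj0 [y Cy gjy]] := gP jo.
have irrC : irreducible (C j.+1) by have [/(_ _ lt_je)[]] := chC.
(* The truncated subtraction is harmless: the coefficients with [a jo < v] are already known to
   vanish. *)
pose Q := \sum_(a | same j.+1 b a) c a *:
   (g jo ^+ (a jo - v) * \prod_(l < e | (l < j)%N) g l ^+ a l).
have prodS (a' : {ffun 'I_e -> 'I_N}) : \prod_(l < e | (l < j.+1)%N) g l ^+ a' l =
    g jo ^+ a' jo * \prod_(l < e | (l < j)%N) g l ^+ a' l.
  rewrite (bigD1 jo) //=; congr (_ * _); apply: eq_bigl => l.
  by rewrite -val_eqE /= ltnS ltn_neqAle andbC.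
have Q0 : forall x, C j.+1 x -> ev Q x = 0.
  have [|//] : (forall x, C j.+1 x -> ev (g jo ^+ v) x = 0) \/
      (forall x, C j.+1 x -> ev Q x = 0).
    apply: irreducible_mul => //; [by exists (g jo ^+ v)|by exists Q|].
    move=> x /c0 x0; rewrite -[RHS]x0 !evE mulr_sumr.
    apply: eq_bigr => a' a'b; have [lt_av|le_va] := ltnP (a' jo) v.
      by rewrite (IHv _ a'b lt_av) !mul0r mulr0.
    rewrite prodS -{2}(subnKC le_va) exprD mulrCA /ev !mevalM; ring.
  move/(_ y Cy)/eqP; rewrite /ev rmorphXn expf_eq0 => /andP[_].
  by rewrite (negPf gjy).
apply: (IHj (ltnW lt_je) a) => [x Cx|]; last first.
  by apply/forallP => l; rewrite eqxx implybT.
have CSx : C j.+1 x by have [_ /(_ _ lt_je)[+ _]] := chC; apply.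
rewrite -(Q0 x CSx) /Q !evE [RHS](bigID (fun a' : {ffun 'I_e -> 'I_N} =>
  a' jo == a jo)) /=.
rewrite [X in _ = _ + X]big1 ?addr0 => [|a' /andP[a'b a'jo]]; last first.
  have [lt_av|] := ltnP (a' jo) v; first by rewrite (IHv _ a'b lt_av) mul0r.
  rewrite leq_eqVlt => /orP[/eqP e1|lt_va].
    by case/eqP: a'jo; apply: val_inj; rewrite /= av e1.
  have := gj0 x Cx; rewrite /ev mevalM rmorphXn /= => ->.
  by rewrite expr0n subn_eq0 leqNgt lt_va mul0r mulr0.
apply: eq_big => [a'|a' /forallP a'a]; last first.
  have /eqP -> : a' jo == a jo by have := a'a jo; rewrite /= leqnn.
  by rewrite av subnn expr0 mul1r.
apply/forallP/andP => [a'a|[/forallP a'b /eqP a'jo] l].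
  split; last by have := a'a jo; rewrite /= leqnn.
  apply/forallP => l; apply/implyP => lt_jl.
  have := a'a l; rewrite (ltnW lt_jl) => /eqP ->.
  by have /forallP/(_ l) := ab; rewrite lt_jl.
apply/implyP; rewrite leq_eqVlt => /orP[/eqP e1|lt_jl].
  by have -> : l = jo by [apply: val_inj]; rewrite a'jo.
have := a'b l; have /forallP/(_ l) := ab.
by rewrite lt_jl => /eqP -> /eqP ->.
Qed.

Lemma msize_mul_le d (P Q : {mpoly F[d]}) a b :
  (msize P <= a.+1 -> msize Q <= b.+1 -> msize (P * Q) <= (a + b).+1)%N.
Proof.
have [->|P0] := eqVneq P 0; first by rewrite mul0r msize0.
have [->|Q0] := eqVneq Q 0; first by rewrite mulr0 msize0.
by rewrite msizeM //; move: (msize P) (msize Q) => x y; lia.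
Qed.

Lemma msize_exp_le d (P : {mpoly F[d]}) D m :
  (msize P <= D.+1)%N -> (msize (P ^+ m) <= (D * m).+1)%N.
Proof.
move=> PD; elim: m => [|m IH]; first by rewrite expr0 msize1.
by rewrite exprS mulnS msize_mul_le.
Qed.

Lemma msize_prod_le d I (r : seq I) (f : I -> {mpoly F[d]}) D :
  (forall i, msize (f i) <= D.+1)%N ->
  (msize (\prod_(i <- r) f i) <= (D * size r).+1)%N.
Proof.
move=> fD; elim: r => [|i r IH]; first by rewrite big_nil msize1.
by rewrite big_cons mulnS msize_mul_le.
Qed.

(* The N ^ e monomials in the P l with exponents below N live in a space of
   dimension O(N ^ d). *)
Lemma mpoly_dependent d e (P : 'I_e -> {mpoly F[d]}) :
  (d < e)%N ->
  exists N (c : {ffun 'I_e -> 'I_N} -> F),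
    (exists a, c a != 0) /\ \sum_a c a *: \prod_l P l ^+ a l = 0.
Proof.
move=> lt_de; pose D := (\max_l msize (P l))%N.
(* [K] bounds the size of every monomial. As [K <= N * (D * e).+1], the choice of [N] gives
   [K ^ d < N ^ d.+1 <= N ^ e]: fewer coefficients than monomials. *)
pose N := ((D * e).+1 ^ d).+1; pose K := (D * N * e).+1.
pose mono (a : {ffun 'I_e -> 'I_N}) := \prod_l P l ^+ a l.
have mono_size a : (msize (mono a) <= K)%N.
  rewrite /K -[X in (_ * X).+1](card_ord e) -[in X in (_ * X).+1](size_enum_ord e).
  rewrite card_ord /mono -big_enum; apply: msize_prod_le => l.
  apply: (@leq_trans (D * a l).+1).
    by apply: msize_exp_le; apply/leqW/leq_bigmax.
  by rewrite ltnS leq_mul2l (ltnW (ltn_ord _)) orbT.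
pose B := \matrix_(i < #|{ffun 'I_e -> 'I_N}|, j < #|{ffun 'I_d -> 'I_K}|)
  (mono (enum_val i))@_[multinom (enum_val j l : nat) | l < d].
have card_lt : (#|{ffun 'I_d -> 'I_K}| < #|{ffun 'I_e -> 'I_N}|)%N.
  rewrite !card_ffun !card_ord; apply: (@leq_trans (N ^ d.+1)); last first.
    by rewrite leq_pexp2l.
  apply: (@leq_ltn_trans ((N * (D * e).+1) ^ d)); last first.
    by rewrite expnMn expnSr ltn_pmul2l ?expn_gt0.
  have leX m a b : (a <= b -> a ^ m <= b ^ m)%N.
    by case: m => // m; rewrite leq_exp2r.
  by apply: leX; rewrite /K /N; move: ((D * e).+1 ^ d)%N => x; nia.
have : kermx B != 0.
  rewrite kermx_eq0 /row_free neq_ltn (leq_ltn_trans (rank_leq_col B)) //.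
move=> /rowV0Pn[v /sub_kermxP vB v0].
exists N, (fun a => v 0 (enum_rank a)); split.
  have /rV0Pn[i vi] := v0; exists (enum_val i); by rewrite enum_valK.
apply/mpolyP => m; rewrite mcoeff0 raddf_sum /=.
have [lt_mK|le_Km] := ltnP (mdeg m) K; last first.
  apply: big1 => a _; rewrite mcoeffZ (_ : _@_m = 0) ?mulr0 //.
  apply: memN_msupp_eq0; apply: msize_mdeg_ge.
  exact: leq_trans (mono_size a) le_Km.
have lt_mlK l : (m l < K)%N.
  apply: leq_ltn_trans lt_mK; rewrite mdegE (bigD1 l) //=; exact: leq_addr.
pose b := [ffun l => Ordinal (lt_mlK l)].
move/matrixP/(_ 0 (enum_rank b)): vB; rewrite !mxE => vB; rewrite -[RHS]vB.
rewrite (reindex_onto enum_val enum_rank) => [|a _]; last exact: enum_rankK.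
apply: eq_big => [i|i _]; first by rewrite enum_valK eqxx.
rewrite mcoeffZ enum_valK mxE; congr (_ * _@_ _).
by apply/mnmP => l; rewrite mnmE enum_rankK ffunE.
Qed.

(** A chain longer than [p * q] would supply more than [p * q] separating functions. Their pullbacks
    along [phi] satisfy a relation, which then holds on the image and on its closure, against the
    freeness of the monomials. *)
Lemma chain_length_bound p q (phi : 'M[F]_(p, q) -> 'M[F]_n) Y e C :
  alg_mx (@polyfun F p q) phi -> Y `<=` zariski_closure (range phi) ->
  irreducible_chain Y e C -> (e <= p * q)%N.
Proof.
move=> pphi Yphi chC; rewrite leqNgt; apply/negP => lt_e.
have /choice[g gP] (j : 'I_e) : exists P : {mpoly F[n * n]},
    (forall x, C j x -> ev P x = 0) /\ exists2 x, C j.+1 x & ev P x != 0.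
  exact: chain_separation chC (ltn_ord j).
have /choice[G GP] (j : 'I_e) : exists P : {mpoly F[p * q]},
    forall x, ev (g j) (phi x) = P.@[fun i => mxvec x 0 i].
  have algP := polyfun_algebra F p q.
  have [|P] := polyfun_comp (f := ev (g j)) algP _ pphi; first by exists (g j).
  by exists P.
have [N [c [[a ca] cG]]] := mpoly_dependent G lt_e.
have /negP[] := ca; apply/eqP; apply: (chain_monomials_free chC gP) => x Cx.
have Yx : Y x by have [/(_ e (leqnn e))[[A _ eqC] _] _] := chC;
  move: Cx; rewrite eqC => -[].
have /zariski_closureP := Yphi _ Yx; apply.
  by exists (\sum_a c a *: \prod_l g l ^+ a l).
move=> _ [y _ <-]; rewrite -[RHS](meval0 (fun i => mxvec y 0 i)) -cG /ev.
rewrite !rmorph_sum; apply: eq_bigr => b _ /=; rewrite !mevalZ; congr (_ * _).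
rewrite !rmorph_prod; apply: eq_bigr => l _ /=; rewrite !rmorphXn /=.
by rewrite -GP.
Qed.

End KrullUpperBound.

(** * Lower bounds for the length of chains *)

Section CoordinateChain.
Variables (F : numFieldType) (n p q : nat).

(** The members of the chain come from letting the first [j] positions of [E] vary and freezing all
    other entries at [a]. The inclusion at each stage is strict because the matrix entry [coord e]
    of the new position [e] stops being constant. *)
Lemma coordinate_chain (phi : 'M[F]_(p, q) -> 'M[F]_n)
    (d : 'M[F]_(p, q) -> F) (a : 'M[F]_(p, q)) (Y : set 'M[F]_n)
    (E : seq ('I_p * 'I_q)) (level : 'I_p * 'I_q -> nat)
    (coord : 'I_p * 'I_q -> 'I_n * 'I_n) :
  alg_mx (@polyfun F p q) phi -> polyfun d -> d a != 0 ->
  (forall x, d x != 0 -> Y (phi x)) -> uniq E ->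
  (forall e (x : 'M[F]_(p, q)), e \in E ->
    (forall e', (e' \notin E) || (level e < level e')%N ->
      x e'.1 e'.2 = a e'.1 e'.2) ->
    phi x (coord e).1 (coord e).2 = x e.1 e.2) ->
  exists C, irreducible_chain Y (size E) C.
Proof.
move=> pphi pd da Yphi uE coordE.
have algP := polyfun_algebra F p q; have algH := horner_algebra F.
pose lev_le e e' := (level e <= level e')%N.
(* Releasing positions by increasing level keeps those of higher level than the new one frozen, as
   [coordE] demands. *)
pose s := sort lev_le E.
have lev_tot : total lev_le by move=> x y; exact: leq_total.
have lev_tr : transitive lev_le by move=> y x z; exact: leq_trans.
have us : uniq s by rewrite sort_uniq.
have ss : sorted lev_le s by exact: sort_sorted.
pose res j (x : 'M[F]_(p, q)) :=
  \matrix_(i, l) if (i, l) \in take j s then x i l else a i l.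
have res_alg D (C : (D -> F) -> Prop) j (g : D -> 'M[F]_(p, q)) :
    function_algebra C -> alg_mx C g -> alg_mx C (fun y => res j (g y)).
  move=> algC Cg i l.
  have -> : (fun y => res j (g y) i l) =
      fun y => if (i, l) \in take j s then g y i l else a i l.
    by apply: funext => y; rewrite mxE.
  by case: (_ \in _) => //; apply: alg_cst.
have coordP : alg_mx (@polyfun F p q) id by move=> i l; exact: polyfun_coord.
have res_id j m x : (j <= m)%N -> res m (res j x) = res j x.
  move=> jm; apply/matrixP => i l; rewrite mxE; case: ifPn => // nin.
  rewrite mxE ifN //; apply: contra nin => il.
  by rewrite -(subnKC jm) takeD mem_cat il.
pose I j := [set phi (res j x) | x in [set x | d (res j x) != 0]].
exists (fun j => zariski_closure (I j) `&` Y); split=> j lt_j.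
  split.
    exists (zariski_closure (I j)); first exact: zariski_closure_closed.
    exact: setIC.
  apply: (@irreducible_image F p q n (fun x => phi (res j x)) (fun x =>
    d (res j x)) a).
  - by move=> i l; apply: (polyfun_comp (f := fun x => phi x i l)) => //;
      exact: res_alg.
  - by apply: polyfun_comp => //; exact: res_alg.
  - suff -> : res j a = a by [].
    by apply/matrixP => i l; rewrite mxE; case: ifP.
  - by move=> x; exact: Yphi.
split.
  apply: setSI; apply: zariski_closure_min; first exact: zariski_closure_closed.
  move=> _ [x dx <-]; apply: sub_zariski_closure; exists (res j x).
    by rewrite /= res_id.
  by rewrite res_id.
have [e0 _] : exists e0, e0 \in E by case: (E) lt_j => // e0 E' _; exists e0;
  exact: mem_head.
have ltjs : (j < size s)%N by rewrite size_sort.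
set e := nth e0 s j.
have es : e \in s by exact: mem_nth.
have resP m x : (m <= j.+1)%N -> phi (res m x) (coord e).1 (coord e).2 =
  res m x e.1 e.2.
  move=> le_mj; apply: coordE => [|e' He']; first by rewrite -(mem_sort lev_le).
  rewrite mxE ifN //; apply/negP => e's.
  have [i lt_im e'E] : exists2 i, (i < m)%N & e' = nth e0 s i.
    move: e's; rewrite -surjective_pairing => /(nthP e0) H.
    case: H => i; rewrite size_take_min ltn_min => /andP[lt_im _] <-.
    by exists i; rewrite // nth_take.
  have le_ij : (i <= j)%N by rewrite -ltnS (leq_trans lt_im).
  move: He'; rewrite e'E -(mem_sort lev_le) mem_nth ?(leq_ltn_trans le_ij) //=.
  rewrite ltnNge => /negP; apply.
  by apply: (sorted_leq_nth lev_tr (fun x => leqnn (level x)) e0 ss) => //;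
    rewrite inE ?(leq_ltn_trans le_ij).
have ntake : (e \in take j s) = false.
  apply/negP => /(nthP e0) H; case: H => i; rewrite size_take ltjs => lt_ij;
    rewrite nth_take // => /eqP.
  by rewrite nth_uniq ?(ltn_trans lt_ij) // => /eqP e1; rewrite e1 ltnn in lt_ij.
(* Only the new entry moves away from the base point; some [t != 0] keeps [d] nonzero, since
   [d a != 0]. *)
pose x t := a + t *: delta_mx e.1 e.2.
have [||t t0 dt] := @horner_fun_nonzero F (fun t => d (res j.+1 (x t))) 0.
- apply: (polyfun_comp algH pd); apply: (res_alg _ _ _ x algH); rewrite /x;
    exact: horner_fun_line.
- rewrite /x scale0r addr0 (_ : res _ a = a) //.
  by apply/matrixP => i l; rewrite mxE; case: ifP.
pose z := phi (res j.+1 (x t)).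
move=> /(_ z) []; first by split; [apply: sub_zariski_closure;
  exists (x t)|exact: Yphi].
(* This function vanishes on [I j], where the entry [e] is frozen, but takes the value [t] at
   [z]. *)
move=> /zariski_closureP /(_ (fun y => y (coord e).1 (coord e).2 - a e.1 e.2)) H _.
case/eqP: t0; rewrite -[RHS]H /z.
- rewrite resP // mxE -surjective_pairing ifT ?/x ?mxE ?eqxx ?mulr1;
    first by rewrite addrAC subrr add0r.
  by rewrite (take_nth e0) // mem_rcons mem_head.
- by apply: (algD (polyfun_algebra F n n));
    [exact: polyfun_coord|exact: alg_cst (polyfun_algebra F n n) _].
- by move=> _ [y _ <-]; rewrite resP // mxE -surjective_pairing ntake subrr.
Qed.

End CoordinateChain.

Section CodimensionOne.
Variables (F : fieldType) (n : nat).

(** Every chain in [Z] is prolonged by putting [Y] on top. Hence the upper bound for [Y] bounds the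
    chains of [Z] by [d], and the chain of length [d] in [Z] yields one of length [d.+1] in [Y]. *)
Lemma codim_one (Y Z A : set 'M[F]_n) d :
  irreducible Y -> zariski_closed A -> Z = Y `&` A -> ~ Y `<=` Z ->
  (forall e C, irreducible_chain Y e C -> (e <= d.+1)%N) ->
  (exists C, irreducible_chain Z d C) -> has_codim Y Z 1.
Proof.
move=> irrY clA eqZ nYZ le_d [C0 chC0].
have extend e C : irreducible_chain Z e C ->
    irreducible_chain Y e.+1 (fun i => if (i <= e)%N then C i else Y).
  move=> [clC incrC]; split=> i; last first.
    move=> le_ie; have [eq_ie|lt_ie] := eqVneq i e; last first.
      have {}lt_ie : (i < e)%N by rewrite ltn_neqAle lt_ie.
      by rewrite (ltnW lt_ie) lt_ie; apply: incrC.
    rewrite {}eq_ie.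
    rewrite leqnn ltnn; split=> [x|YC].
      by have [[B _ ->] _] := clC e (leqnn e); rewrite eqZ => -[[]].
    apply: nYZ => x /YC; have [[B _ ->] _] := clC e (leqnn e).
    by case.
  case: ifPn => [/clC[[B clB ->] irrC] _|_ _].
    split=> //; exists (A `&` B); first exact: zariski_closedI.
    by rewrite eqZ setIA.
  split=> //; exists setT; last by rewrite setIT.
  by exists set0; apply/seteqP; split=> [x _ P|x].
exists d.+1, d; split; last by rewrite -addn1 PoszD addrC addKr.
  by split; [exists (fun i => if (i <= d)%N then C0 i else Y); exact: extend|].
split; first by exists C0.
by move=> e C /extend /le_d.
Qed.

End CodimensionOne.

(** * Square-zero matrices in echelon form *)

Section CoordinateSpace.
Variables (F : fieldType) (k : nat).
Implicit Types (J : pred 'I_k) (v : 'rV[F]_k).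

Definition coord_space J : 'M[F]_k := (\sum_(r | J r) <<delta_mx 0 r : 'rV_k>>)%MS.

Lemma rank_coord_space J : \rank (coord_space J) = #|J|.
Proof.
rewrite /coord_space (mxdirectP _) /=; last exact: mxdirect_delta.
rewrite -sum1_card; apply: eq_bigr => r _.
by rewrite mxrank_gen mxrank_delta.
Qed.

Lemma sub_coord_space J v :
  reflect (forall r, ~~ J r -> v 0 r = 0) (v <= coord_space J)%MS.
Proof.
apply: (iffP idP) => [/sub_sumsmxP[w ->] r Jr|vJ].
  rewrite summxE big1 // => l Jl.
  have /submxP[c ->] : (w l *m <<(delta_mx 0 l : 'rV[F]_k)>> <=
    (delta_mx 0 l : 'rV[F]_k))%MS.
    by rewrite (submx_trans (submxMl _ _)) // genmxE.
  rewrite mxE big_ord1 mxE eqxx; case: eqVneq => [e|_]; last by rewrite mulr0.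
  by rewrite e Jl in Jr.
rewrite [v]row_sum_delta; apply: summx_sub => r _.
have [Jr|/vJ ->] := boolP (J r); last by rewrite scale0r sub0mx.
by apply: scalemx_sub; rewrite (sumsmx_sup r) // genmxE.
Qed.

Lemma coord_space_sub J m (B : 'M[F]_(m, k)) :
  (forall r, J r -> ((delta_mx 0 r : 'rV[F]_k) <= B)%MS) -> (coord_space J <= B)%MS.
Proof. by move=> JB; apply/sumsmx_subP => r /JB; rewrite genmxE. Qed.

Lemma rank_pivots J m (B : 'M[F]_(m, k)) :
  (forall r, J r -> ((delta_mx 0 r : 'rV[F]_k) <= B)%MS) ->
  (forall j r, ~~ J r -> B j r = 0) -> \rank B = #|J|.
Proof.
move=> /coord_space_sub JB BJ; rewrite -rank_coord_space.
apply/eqP; rewrite eqn_leq !mxrankS //; apply/row_subP => j.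
by apply/sub_coord_space => r Jr; rewrite mxE BJ.
Qed.

(** Modulo [coord_space J] every row is a multiple of [z] and row [j0] is a nonzero one, so exactly
    one dimension is added. This detects the pivot created by a deformation. *)
Lemma rank_pivotsS J m (B : 'M[F]_(m, k)) (z : 'rV[F]_k) r0 j0 c0 :
  (forall r, J r -> ((delta_mx 0 r : 'rV[F]_k) <= B)%MS) ->
  (forall j, exists c, forall r, ~~ J r -> B j r = c * z 0 r) ->
  ~~ J r0 -> z 0 r0 != 0 -> c0 != 0 ->
  (forall r, ~~ J r -> B j0 r = c0 * z 0 r) -> \rank B = #|J|.+1.
Proof.
move=> /coord_space_sub JB Bz Jr0 zr0 c00 Bj0.
have eqB : (B :=: coord_space J + z)%MS.
  apply/eqmxP/andP; split.
    apply/row_subP => j; have [c Bj] := Bz j.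
    rewrite -[row j B](subrK (c *: z)) addmx_sub_adds ?scalemx_sub //.
    by apply/sub_coord_space => r Jr; rewrite !mxE Bj // subrr.
  rewrite addsmx_sub JB /=.
  have -> : z = c0^-1 *: (row j0 B - (row j0 B - c0 *: z)).
    by rewrite subKr scalerA mulVf // scale1r.
  rewrite scalemx_sub // addmx_sub ?row_sub // eqmx_opp (submx_trans _ JB) //.
  by apply/sub_coord_space => r Jr; rewrite !mxE Bj0 // subrr.
rewrite eqB -rank_coord_space; apply/eqP; rewrite eqn_leq; apply/andP; split.
  rewrite (leq_trans (mxrank_adds_leqif _ _)) // -[X in (_ <= X)%N]addn1 leq_add2l.
  exact: rank_leq_row.
suff : (coord_space J < coord_space J + z)%MS by rewrite ltmxErank => /andP[].
rewrite /ltmx addsmxSl addsmx_sub submx_refl /=.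
by apply: contra zr0 => /sub_coord_space /(_ r0 Jr0) ->.
Qed.

End CoordinateSpace.

(** A nonzero term [A i j * B j l] forces [f i < g j < h l]: triangularity is measured by positions
    in the ambient basis. *)
Lemma mulmx_upper (F : fieldType) p q r (f : 'I_p -> nat) (g : 'I_q -> nat)
    (h : 'I_r -> nat) (A : 'M[F]_(p, q)) (B : 'M[F]_(q, r)) :
  (forall i j, (g j <= f i)%N -> A i j = 0) ->
  (forall j l, (h l <= g j)%N -> B j l = 0) ->
  forall i l, (h l <= f i)%N -> (A *m B) i l = 0.
Proof.
move=> A0 B0 i l hf; rewrite mxE big1 // => j _.
have [/A0 ->|/ltnW gf] := leqP (g j) (f i); first by rewrite mul0r.
by rewrite B0 ?mulr0 // (leq_trans hf).
Qed.

Section ColumnRank.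
Variables (F : fieldType) (n : nat).

Lemma rank_upper_left (x : 'M[F]_n) m (le_mn : (m <= n)%N) :
  strictly_upper F n x ->
  \rank (upper_left le_mn x) = \rank (colsub (widen_ord le_mn) x).
Proof.
move=> ux; apply/eqP; rewrite eqn_leq; apply/andP; split; apply: mxrankS.
  apply/row_subP => i; rewrite (_ : row i _ = row (widen_ord le_mn i)
    (colsub (widen_ord le_mn) x)) ?row_sub //.
  by apply/rowP => j; rewrite !mxE.
apply/row_subP => i; have [lt_im|le_mi] := ltnP i m.
  rewrite (_ : row i _ = row (Ordinal lt_im) (upper_left le_mn x)) ?row_sub //.
  by apply/rowP => j; rewrite !mxE; congr (x _ _); apply: val_inj.
rewrite (_ : row i _ = 0) ?sub0mx //; apply/rowP => j; rewrite !mxE.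
by rewrite ux //= (leq_trans (ltnW (ltn_ord j))).
Qed.

(* When the ranks of the initial blocks jump exactly at the columns b r, these
   columns span, and reducing by them gives an echelon factor. *)
Lemma echelon_factor k (b : 'I_k -> 'I_n) (x : 'M[F]_n) :
  injective b ->
  (forall m (le_mn : (m <= n)%N),
     \rank (colsub (widen_ord le_mn) x) = #|[pred r | b r < m]%N|) ->
  exists V : 'M[F]_(k, n),
    [/\ x = colsub b x *m V, forall s r, V s (b r) = (s == r)%:R
      & forall s (j : 'I_n), (j < b s)%N -> V s j = 0].
Proof.
move=> b_inj rk_x; pose y := x^T.
pose S m (le_mn : (m <= n)%N) := rowsub (widen_ord le_mn) y.
have rk_S m le_mn : \rank (@S m le_mn) = #|[pred r | b r < m]%N|.
  rewrite -(rk_x _ le_mn) -mxrank_tr; congr (\rank _).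
  by apply/matrixP => i j; rewrite !mxE.
(* [S m] holds the first [m] columns of [x] as rows; [R m] holds the pivot columns among them,
   padded by zero rows. *)
pose R m : 'M[F]_(k, n) := \matrix_r if (b r < m)%N then row (b r) y else 0.
have RS m : (R m <= R m.+1)%MS.
  apply/row_subP => r; rewrite rowK; case: ifP => [lt_rm|_]; last exact: sub0mx.
  have -> : row (b r) y = row r (R m.+1) by rewrite rowK ltnW.
  exact: row_sub.
(* At a pivot the new column belongs to [R m.+1]; elsewhere the rank does not jump, so the new
   column lies in the span of the previous ones. *)
have SR m le_mn : (@S m le_mn <= R m)%MS.
  elim: m le_mn => [|m IH] lt_mn; first by apply/row_subP => -[].
  have le_mn := ltnW lt_mn.
  have SS : (S _ le_mn <= S _ lt_mn)%MS.
    apply: (@submx_rowsub _ _ _ _ _ (widen_ord (leqnSn m))) => i.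
    exact: val_inj.
  case: (pickP (fun r => b r == Ordinal lt_mn)) => [r /eqP br|nb].
    apply/row_subP => i; have [lt_im|] := ltnP i m.
      rewrite (_ : row i _ = row (Ordinal lt_im) (S _ le_mn)).
        by rewrite (submx_trans (row_sub _ _)) // (submx_trans (IH _)).
      by apply/rowP => j; rewrite !mxE; congr (x _ _); apply: val_inj.
    move=> le_mi; have -> : row i (S _ lt_mn) = row r (R m.+1).
      rewrite rowK br /= leqnn; apply/rowP => j; rewrite !mxE; congr (x _ _).
      by apply: val_inj => /=; apply/eqP; rewrite eqn_leq le_mi -ltnS ltn_ord.
    exact: row_sub.
  have : (S _ lt_mn <= S _ le_mn)%MS.
    rewrite -(geq_leqif (mxrank_leqif_sup SS)) !rk_S.
    apply/subset_leq_card/fintype.subsetP => r; rewrite !inE ltnS leq_eqVlt.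
    by have := nb r; rewrite -val_eqE /= => ->.
  by move=> /submx_trans; apply; apply: submx_trans (IH _) (RS m).
(* The coordinates of column [j] are chosen to use pivots at or before [j] only, and to be a unit
   vector when [j] is itself a pivot. *)
have /fin_all_exists[v vP] (j : 'I_n) : exists v : 'rV[F]_k,
    [/\ row j y = v *m (\matrix_r row (b r) y),
        forall r, j = b r -> v = delta_mx 0 r
      & forall s, (j < b s)%N -> v 0 s = 0].
  case: (pickP (fun r => b r == j)) => [r /eqP <-|nb].
    exists (delta_mx 0 r); split=> [|r' /b_inj -> //|s].
      by rewrite -rowE rowK.
    by rewrite mxE eqxx; case: eqVneq => /= [->|]; rewrite ?ltnn.
  have : (row j y <= R j.+1)%MS.
    apply: submx_trans (SR _ (ltn_ord j)).
    rewrite (_ : row j y = row ord_max (S _ (ltn_ord j))) ?row_sub //.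
    by apply/rowP => i; rewrite !mxE; congr (x _ _); apply: val_inj.
  case/submxP => c cP; exists (\row_s if (b s < j.+1)%N then c 0 s else 0).
  split=> [|r jb|s lt_js]; last by rewrite mxE ltnNge lt_js.
    apply/rowP => i; rewrite cP !mxE; apply: eq_bigr => s _; rewrite !mxE.
    by case: ifP => _; rewrite !mxE ?mulr0 ?mul0r.
  by have := nb r; rewrite jb eqxx.
exists (\matrix_(s, j) v j 0 s); split=> [|s r|s j lt_js]; rewrite ?mxE.
- apply/matrixP => i j; have [/rowP/(_ i) e _ _] := vP j.
  rewrite !mxE in e; rewrite e mxE; apply: eq_bigr => s _.
  by rewrite !mxE mulrC.
- by have [_ /(_ r erefl) -> _] := vP (b r); rewrite mxE eqxx.
- by have [_ _ ->] := vP j.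
Qed.

End ColumnRank.

(** * Block coordinates for square-zero matrices *)

Section BlockParametrization.
Variables (F : fieldType) (n p k : nat) (u : 'I_p -> 'I_n) (b : 'I_k -> 'I_n).
Hypotheses (u_inj : injective u) (b_inj : injective b).
Hypothesis (ub : forall m r, u m != b r).
Hypothesis (cover : forall j, (exists m, j = u m) \/ (exists r, j = b r)).
Implicit Types (L : 'M[F]_(k, p)) (M : 'M[F]_(p, k)).

Let U : 'M[F]_(p, n) := rowsub u 1%:M.
Let B : 'M[F]_(k, n) := rowsub b 1%:M.

(* In the basis (u, b), square_zero L M is [M L, M; - L M L, - L M]. *)
Definition echelon L : 'M[F]_(k, n) := L *m rowsub u 1%:M + rowsub b 1%:M.

(** These columns lie in the kernel of [echelon L] and are determined by their entries [M] in the
    rows [u]; hence [square_zero L M] squares to zero. *)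
Definition lift_cols L M : 'M[F]_(n, k) :=
  ((rowsub u 1%:M)^T - (rowsub b 1%:M)^T *m L) *m M.

Definition square_zero L M : 'M[F]_n := lift_cols L M *m echelon L.

Lemma rowsub1E q r (f : 'I_q -> 'I_n) (A : 'M[F]_(n, r)) :
  rowsub f 1%:M *m A = rowsub f A.
Proof. by rewrite mul_rowsub_mx mul1mx. Qed.

Lemma colsub1E q r (f : 'I_q -> 'I_n) (A : 'M[F]_(r, n)) :
  A *m (rowsub f 1%:M)^T = colsub f A.
Proof.
rewrite -[LHS]trmxK trmx_mul trmxK rowsub1E.
by apply/matrixP => i j; rewrite !mxE.
Qed.

Lemma UUt : U *m U^T = 1%:M.
Proof. by rewrite rowsub1E; apply/matrixP => i j;
  rewrite !mxE inj_eq // eq_sym. Qed.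

Lemma BBt : B *m B^T = 1%:M.
Proof. by rewrite rowsub1E; apply/matrixP => i j;
  rewrite !mxE inj_eq // eq_sym. Qed.

Lemma UBt : U *m B^T = 0.
Proof.
by rewrite rowsub1E; apply/matrixP => i j; rewrite !mxE eq_sym (negPf (ub _ _)).
Qed.

Lemma BUt : B *m U^T = 0.
Proof. by rewrite -[LHS]trmxK trmx_mul trmxK UBt trmx0. Qed.

Lemma UB1 : U^T *m U + B^T *m B = 1%:M.
Proof.
apply/matrixP => i j; rewrite !mxE.
have sum1 q (f : 'I_q -> 'I_n) : injective f ->
    \sum_l (rowsub f 1%:M)^T i l * rowsub f 1%:M l j
    = [exists l, i == f l]%:R * (i == j)%:R :> F.
  move=> f_inj; case: existsP => [[l /eqP ->]|ni].
    rewrite (bigD1 l) //= !mxE eqxx big1 ?addr0 // => l' l'l; rewrite !mxE.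
    by rewrite (inj_eq f_inj) (negPf l'l) mul0r.
  rewrite mul0r big1 // => l _; rewrite !mxE; case: eqVneq => [e|_].
    by case: ni; exists l; rewrite e.
  by rewrite mul0r.
rewrite !sum1 // -mulrDl -natrD.
suff -> : ([exists l, i == u l] + [exists l, i == b l] = 1)%N by rewrite mul1r.
case: (cover i) => -[l il].
  have /existsP -> : exists l, i == u l by exists l; apply/eqP.
  suff -> : [exists l, i == b l] = false by [].
  by apply/existsP => -[r /eqP ir]; have := ub l r; rewrite -il ir eqxx.
have /existsP -> : exists l, i == b l by exists l; apply/eqP.
suff -> : [exists l, i == u l] = false by [].
by apply/existsP => -[m /eqP im]; have := ub m l; rewrite -im il eqxx.
Qed.

Lemma echelon_lift_cols L M : echelon L *m lift_cols L M = 0.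
Proof.
rewrite /echelon /lift_cols -/U -/B mulmxA mulmxBr !mulmxDl.
rewrite -(mulmxA L U U^T) UUt BUt -(mulmxA L U) !(mulmxA _ B^T L) UBt BBt.
by rewrite mulmx1 !mul0mx mulmx0 mul1mx addr0 add0r mulNmx subrr.
Qed.

Lemma square_zero_sqr L M : square_zero L M *m square_zero L M = 0.
Proof.
by rewrite /square_zero -mulmxA (mulmxA (echelon L)) echelon_lift_cols mul0mx mulmx0.
Qed.

Lemma echelon_u L s a : echelon L s (u a) = L s a.
Proof.
have LU : echelon L *m U^T = L.
  by rewrite /echelon -/U -/B mulmxDl -mulmxA UUt BUt mulmx1 addr0.
by rewrite -[in RHS]LU colsub1E [RHS]mxE.
Qed.

Lemma echelon_b L s r : echelon L s (b r) = (s == r)%:R.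
Proof.
have LB : echelon L *m B^T = 1%:M.
  by rewrite /echelon -/U -/B mulmxDl -mulmxA UBt BBt mulmx0 add0r.
have <- : (1%:M : 'M[F]_k) s r = (s == r)%:R by rewrite mxE.
by rewrite -LB colsub1E [RHS]mxE.
Qed.

Lemma rowsub_u_lift_cols L M : rowsub u (lift_cols L M) = M.
Proof.
rewrite -rowsub1E -/U /lift_cols -/U -/B mulmxA mulmxBr UUt mulmxA UBt.
by rewrite mul0mx subr0 mul1mx.
Qed.

Lemma rowsub_b_lift_cols L M : rowsub b (lift_cols L M) = - (L *m M).
Proof.
rewrite -rowsub1E -/B /lift_cols -/U -/B mulmxA mulmxBr BUt mulmxA BBt.
by rewrite mul1mx sub0r mulNmx.
Qed.

Lemma square_zero_ub L M m r : square_zero L M (u m) (b r) = M m r.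
Proof.
rewrite mxE (bigD1 r) //= echelon_b eqxx mulr1 big1 ?addr0.
  by have /matrixP/(_ m r) := rowsub_u_lift_cols L M; rewrite mxE.
by move=> s /negPf sr; rewrite echelon_b sr mulr0.
Qed.

Lemma square_zero_bb L M s r : square_zero L M (b s) (b r) = - (L *m M) s r.
Proof.
rewrite mxE (bigD1 r) //= echelon_b eqxx mulr1 big1 ?addr0.
  have /matrixP/(_ s r) := rowsub_b_lift_cols L M; rewrite mxE => ->.
  by rewrite mxE.
by move=> l /negPf lr; rewrite echelon_b lr mulr0.
Qed.

Lemma square_zero_uu L M m a : square_zero L M (u m) (u a) = (M *m L) m a.
Proof.
rewrite !mxE; apply: eq_bigr => r _; rewrite echelon_u.
by have /matrixP/(_ m r) := rowsub_u_lift_cols L M; rewrite mxE => ->.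
Qed.

Lemma square_zero_bu L M s a :
  square_zero L M (b s) (u a) = - (L *m M *m L) s a.
Proof.
rewrite !mxE -sumrN; apply: eq_bigr => r _; rewrite echelon_u -mulNr.
have /matrixP/(_ s r) := rowsub_b_lift_cols L M; rewrite mxE => ->.
by rewrite mxE.
Qed.

Lemma square_zero_upper L M :
  (forall m r, (b r <= u m)%N -> M m r = 0) ->
  (forall s r, (b r <= b s)%N -> (L *m M) s r = 0) ->
  (forall m a, (u a <= u m)%N -> (M *m L) m a = 0) ->
  (forall s a, (u a <= b s)%N -> (L *m M *m L) s a = 0) ->
  strictly_upper F n (square_zero L M).
Proof.
move=> ub0 bb0 uu0 bu0 i j.
have [[m ->]|[s ->]] := cover i; have [[a ->]|[r ->]] := cover j => le_ji.
- by rewrite square_zero_uu uu0.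
- by rewrite square_zero_ub ub0.
- by rewrite square_zero_bu bu0 ?oppr0.
- by rewrite square_zero_bb bb0 ?oppr0.
Qed.

Lemma rank_lift_cols L M : \rank (lift_cols L M) = \rank M.
Proof.
apply/eqP; rewrite eqn_leq mxrankM_maxr /=.
by rewrite -{1}(rowsub_u_lift_cols L M) -rowsub1E mxrankM_maxr.
Qed.

Lemma rank_colsub_square_zero L M m (f : 'I_m -> 'I_n) :
  \rank M = k -> \rank (colsub f (square_zero L M)) = \rank (colsub f (echelon L)).
Proof.
move=> rkM.
have -> : colsub f (square_zero L M) = lift_cols L M *m colsub f (echelon L).
  by rewrite /square_zero mulmx_colsub.
rewrite -mxrank_tr trmx_mul mxrankMfree ?mxrank_tr //.
by rewrite /row_free mxrank_tr rank_lift_cols rkM.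
Qed.

Lemma rank_square_zero L M : \rank M = k -> \rank (square_zero L M) = k.
Proof.
move=> rkM; apply/eqP; rewrite eqn_leq (leq_trans (mxrankM_maxl _ _)) ?rank_lift_cols ?rkM //=.
rewrite -{1}rkM -(rank_lift_cols L).
have -> : lift_cols L M = square_zero L M *m B^T.
  rewrite /square_zero -mulmxA (_ : echelon L *m B^T = 1%:M) ?mulmx1 //.
  by rewrite /echelon -/U -/B mulmxDl -mulmxA UBt BBt mulmx0 add0r.
exact: mxrankM_maxl.
Qed.

Lemma square_zero_generic T L M :
  strictly_upper F n (square_zero L M) -> \rank M = k ->
  (forall m (le_mn : (m <= n)%N), \rank (colsub (widen_ord le_mn) (echelon L))
      = count (fun b => b <= m)%N T.2) ->
  generic_part F n k T (square_zero L M).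
Proof.
move=> upX rkM rkL; split.
  by split=> //; split; [exact: square_zero_sqr|exact: rank_square_zero].
by move=> m le_mn; rewrite rank_upper_left // rank_colsub_square_zero.
Qed.

Lemma generic_square_zero (T : two_column) x :
  (forall m, (m <= n)%N -> count (fun b => b <= m)%N T.2 =
    #|[pred r | b r < m]%N|) ->
  generic_part F n k T x ->
  exists L M, [/\ x = square_zero L M, \rank M = k,
    forall m r, (b r <= u m)%N -> M m r = 0
    & forall r m, (u m <= b r)%N -> L r m = 0].
Proof.
move=> cT [[[xx rkx] upx] rk].
have [|V [xV Vb V0]] := @echelon_factor F n k b x b_inj.
  by move=> m le_mn; rewrite -rank_upper_left // rk cT.
pose P := colsub b x; pose L := V *m U^T; pose M := U *m P.
have BtE : P = x *m B^T.
  by rewrite colsub1E.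
have VB : V *m B^T = 1%:M.
  by rewrite colsub1E; apply/matrixP => s r; rewrite !mxE Vb.
have VL : V = echelon L.
  by rewrite /echelon -/U -/B -[LHS]mulmx1 -UB1 mulmxDr !mulmxA VB mul1mx.
have rkP : \rank P = k.
  apply/eqP; rewrite eqn_leq rank_leq_col /=.
  by have := mxrankM_maxl P V; rewrite -xV rkx => H; exact: H.
(* [P] has full column rank and can be cancelled on the left; [P *m (V *m P)] consists of the
   columns [b] of [x *m x]. *)
have VP : V *m P = 0.
  have Pinj : row_full P by rewrite /row_full rkP.
  by apply: (row_full_inj Pinj); rewrite mulmx0 mulmxA -xV BtE mulmxA xx mul0mx.
have PM : P = lift_cols L M.
  rewrite /lift_cols -/U -/B -[LHS]mul1mx -UB1 mulmxDl mulmxBl -!mulmxA -/M.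
  congr (_ + _); rewrite -mulmxN; congr (_ *m _); apply/eqP.
  have BP : L *m M + B *m P = 0.
    by rewrite -VP [in RHS]VL /echelon -/U -/B mulmxDl /M mulmxA.
  by rewrite (mulmxA V) -addr_eq0 addrC; apply/eqP; exact: BP.
exists L, M; split.
- by rewrite /square_zero -PM -VL.
- by rewrite -(rank_lift_cols L) -PM.
- by move=> m r le_bu; rewrite /M rowsub1E !mxE upx.
- move=> r m le_ub; rewrite -(echelon_u L) -VL V0 //.
  by rewrite ltn_neqAle le_ub andbT; apply: contra (ub m r) => /eqP/val_inj ->.
Qed.

End BlockParametrization.

Lemma rank_unit_rowsub (F : fieldType) p k (M : 'M[F]_(p, k)) (f : 'I_k -> 'I_p) :
  \det (rowsub f M) != 0 -> \rank M = k.
Proof.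
move=> dM; apply/eqP; rewrite eqn_leq rank_leq_col /=.
have {1}<- : \rank (rowsub f M) = k.
  by apply: mxrank_unit; rewrite unitmxE unitfE.
by apply: mxrankS; apply/row_subP => i; rewrite row_rowsub row_sub.
Qed.

(** * Moving a pivot by a one-parameter deformation *)

Section TwoVarieties.
Variables (F : numFieldType) (n p k : nat) (u : 'I_p -> 'I_n) (b : 'I_k -> 'I_n).
Hypotheses (u_inj : injective u) (b_inj : injective b).
Hypothesis (ub : forall m r, u m != b r).
Hypothesis (cover : forall j, (exists m, j = u m) \/ (exists r, j = b r)).
Implicit Types (L : 'M[F]_(k, p)) (M A : 'M[F]_(p, k)).

Local Notation X := (square_zero u b).

Definition upper_ub M := forall m r, (b r <= u m)%N -> M m r = 0.
Definition upper_bu L := forall r m, (u m <= b r)%N -> L r m = 0.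

Lemma square_zero_strictly_upper L M :
  upper_bu L -> upper_ub M -> strictly_upper F n (X L M).
Proof.
move=> L0 M0; apply: square_zero_upper => //.
- exact: (mulmx_upper (f := b) (g := u)).
- exact: (mulmx_upper (f := u) (g := b)).
- apply: (mulmx_upper (f := b) (g := b)) => //.
  exact: (mulmx_upper (f := b) (g := u)).
Qed.

Lemma echelon_row_b L m (le_mn : (m <= n)%N) r :
  (b r < m)%N -> ((delta_mx 0 r : 'rV[F]_k) <=
    (colsub (widen_ord le_mn) (echelon u b L))^T)%MS.
Proof.
move=> lt_bm; rewrite (_ : delta_mx 0 r = row (Ordinal lt_bm)
  (colsub (widen_ord le_mn) (echelon u b L))^T) ?row_sub //.
apply/rowP => s; rewrite mxE eqxx /= [RHS]mxE [RHS]mxE [RHS]mxE.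
rewrite (_ : widen_ord _ _ = b r); last exact: val_inj.
by rewrite echelon_b.
Qed.

(** Since [L] is triangular, the first [m] columns of [echelon L] involve only the pivots before
    [m], and these pivots give unit vectors. *)
Lemma square_zero_in_generic T L M :
  (forall m, (m <= n)%N -> count (fun j => j <= m)%N T.2 =
    #|[pred r | b r < m]%N|) ->
  upper_bu L -> upper_ub M -> \rank M = k -> generic_part F n k T (X L M).
Proof.
move=> cT L0 M0 rkM; apply: square_zero_generic => //.
  exact: square_zero_strictly_upper.
move=> m le_mn; rewrite cT // -mxrank_tr; apply: rank_pivots.
  by move=> r /=; exact: echelon_row_b.
move=> j r /=; rewrite -leqNgt => le_mb; rewrite [LHS]mxE [LHS]mxE.
have : (widen_ord le_mn j < b r)%N := leq_trans (ltn_ord j) le_mb.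
have [[a ->]|[s ->]] := cover (widen_ord le_mn j) => lt_jb.
  by rewrite echelon_u // L0 // ltnW.
by rewrite echelon_b //; case: eqVneq lt_jb => // ->; rewrite ltnn.
Qed.

Variables (s0 : 'I_k) (m0 : 'I_p).
Hypothesis lt_m0 : (u m0 < b s0)%N.

(** The second column of the changed tableau, left unsorted: ranks depend only on how many pivots
    precede [m]. *)
Definition b_swap r := if r == s0 then u m0 else b r.

Lemma b_swap_inj : injective b_swap.
Proof.
have ub' r : u m0 = b r -> False by move/eqP; rewrite (negPf (ub _ _)).
move=> r r'; rewrite /b_swap.
case: eqVneq => [->|_]; case: eqVneq => [->|_] // e.
- by case: (ub' _ e).
- by case: (ub' _ (esym e)).
- exact: b_inj.
Qed.

Lemma card_b_swap m : #|[pred r | b_swap r < m]%N| =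
  (#|[pred r | b r < m]%N| + (u m0 < m <= b s0))%N.
Proof.
rewrite (cardD1 s0) [in RHS](cardD1 s0).
have -> : #|[predD1 [pred r | b_swap r < m]%N & s0]| =
    #|[predD1 [pred r | b r < m]%N & s0]|.
  by apply: eq_card => r; rewrite !inE /b_swap; case: eqVneq.
rewrite !inE /b_swap eqxx; move: #|_| => c.
by have := lt_m0; case: ltnP; case: ltnP; case: leqP => /=; lia.
Qed.

Section SwappedTableau.
Variable T' : two_column.
Hypothesis cT' : forall m, (m <= n)%N ->
  count (fun j => j <= m)%N T'.2 = #|[pred r | b_swap r < m]%N|.

(* Adding t * zeta eta to L leaves the orbit and the strict triangularity
   unchanged, but creates a new pivot in column u m0 in place of b s0. *)
Lemma square_zero_degenerate L M (zeta : 'cV[F]_k) (eta : 'rV[F]_p) :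
  upper_bu L -> upper_ub M -> \rank M = k ->
  zeta s0 0 = 1 -> eta 0 m0 = 1 ->
  (forall r, (b s0 < b r)%N -> zeta r 0 = 0) ->
  (forall m, (u m < u m0)%N -> eta 0 m = 0) ->
  (forall m, (u m0 <= u m)%N -> (M *m zeta) m 0 = 0) ->
  (forall r, (b r <= b s0)%N -> (eta *m M) 0 r = 0) ->
  zariski_closure (generic_part F n k T') (X L M).
Proof.
move=> L0 M0 rkM zs0 em0 z0 e0 Mz eM.
pose Lt t := L + t *: (zeta *m eta).
(* [eta] lives at positions from [u m0] on and [M *m zeta] at positions before it. This removes the
   term of degree two in [t] from the block [L M L]. *)
have eMz : eta *m (M *m zeta) = 0.
  apply/matrixP => i j; rewrite !ord1 mxE [RHS]mxE big1 // => m _.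
  have [/e0 ->|/Mz ->] := ltnP (u m) (u m0); by rewrite ?mul0r ?mulr0.
have LM0 : forall r s, (b s <= b r)%N -> (L *m M) r s = 0.
  exact: (mulmx_upper (f := b) (g := u) (h := b)).
have ML0 : forall m a, (u a <= u m)%N -> (M *m L) m a = 0.
  exact: (mulmx_upper (f := u) (g := b) (h := u)).
have LtM t : Lt t *m M = L *m M + t *: (zeta *m (eta *m M)).
  by rewrite mulmxDl -scalemxAl mulmxA.
have LtM0 t : forall r s, (b s <= b r)%N -> (Lt t *m M) r s = 0.
  move=> r s le_sr; rewrite LtM mxE LM0 // add0r mxE [X in _ * X]mxE big_ord1.
  have [/eM ->|/leq_trans/(_ le_sr)/z0 ->] := leqP (b s) (b s0).
    by rewrite !mulr0.
  by rewrite mul0r mulr0.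
have upX t : strictly_upper F n (X (Lt t) M).
  apply: square_zero_upper => //; first exact: LtM0.
    move=> m a le_am; rewrite mulmxDr mxE ML0 // add0r -scalemxAr mulmxA.
    rewrite mxE [X in _ * X]mxE big_ord1.
    have [/e0 ->|le_0a] := ltnP (u a) (u m0); first by rewrite !mulr0.
    by rewrite Mz ?mul0r ?mulr0 // (leq_trans le_0a).
  move=> s a le_as; rewrite mulmxDr mxE (mulmx_upper (LtM0 t) L0) // add0r.
  rewrite -scalemxAr mulmxA -(mulmxA (Lt t)) mulmxDl -scalemxAl -mulmxA eMz.
  rewrite mulmx0 scaler0 addr0 mxE [X in _ * X]mxE big_ord1.
  have [/e0 ->|le_0a] := ltnP (u a) (u m0); first by rewrite !mulr0.
  suff -> : (L *m (M *m zeta)) s 0 = 0 by rewrite mul0r mulr0.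
  rewrite mxE big1 // => m _.
  have [/Mz ->|lt_m0'] := leqP (u m0) (u m); first by rewrite mulr0.
  by rewrite L0 ?mul0r // (leq_trans (ltnW lt_m0')) // (leq_trans le_0a).
have <- : X (Lt 0) M = X L M by rewrite /Lt scale0r addr0.
apply: (@curve_closure F n _ (fun t => X (Lt t) M)).
  have algH := horner_algebra F.
  have Lt_alg : alg_mx (@horner_fun F) Lt by exact: horner_fun_line.
  have cst q r (C : 'M[F]_(q, r)) : alg_mx (@horner_fun F) (fun=> C).
    exact: alg_mx_cst.
  apply: (alg_mxM algH); last first.
    by apply: (alg_mxD algH) => //; apply: (alg_mxM algH).
  apply: (alg_mxM algH) => //; apply: (alg_mxD algH) => //.
  by apply: (alg_mxN algH); apply: (alg_mxM algH).
move=> t t0; apply: square_zero_generic => // m le_mn.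
rewrite cT' // card_b_swap -mxrank_tr.
set B := (colsub _ _)^T.
have JB r : (b r < m)%N -> ((delta_mx 0 r : 'rV[F]_k) <= B)%MS.
  exact: echelon_row_b.
(* In the coordinates of pivots not yet reached, a column before [m] sees only the added term, a
   multiple of [zeta]. *)
have BE j r : (m <= b r)%N -> B j r =
    (if [pick a | widen_ord le_mn j == u a] is Some a then t * eta 0 a else 0)
    * zeta r 0.
  move=> le_mb; rewrite [LHS]mxE [LHS]mxE; case: pickP => [a /eqP ja|nja].
    have lt_am : (u a < m)%N by rewrite -ja /=.
    rewrite ja echelon_u // mxE L0 ?(leq_trans (ltnW lt_am)) // add0r.
    by rewrite mxE [X in _ * X]mxE big_ord1 mulrA mulrAC.
  have [[a ja]|[s js]] := cover (widen_ord le_mn j).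
    by have := nja a; rewrite ja eqxx.
  rewrite js echelon_b // mul0r; case: eqVneq => // rs.
  have : (b s < m)%N by rewrite -js /=.
  by rewrite -rs ltnNge le_mb.
(* For [u m0 < m <= b s0] column [u m0] adds one dimension. Before that range [eta] vanishes on the
   columns seen; after it [zeta] vanishes on the remaining coordinates. *)
have [/andP[lt_0m le_m0]|] := boolP (u m0 < m <= b s0)%N.
  rewrite addn1.
  apply: (@rank_pivotsS _ _ _ _ _ zeta^T s0 (Ordinal lt_0m) t) => //=.
  - move=> j; exists (if [pick a | widen_ord le_mn j == u a] is Some a
      then t * eta 0 a else 0) => r.
    by rewrite -leqNgt => /BE ->; rewrite mxE.
  - by rewrite -leqNgt.
  - by rewrite mxE zs0 oner_eq0.
  - move=> r; rewrite -leqNgt => /BE ->; rewrite mxE.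
    case: pickP => [a /eqP ja|/(_ m0)/eqP []]; last exact: val_inj.
    suff <- : m0 = a by rewrite em0 mulr1.
    by apply: u_inj; rewrite -ja; apply: val_inj.
move=> nm; rewrite addn0; apply: rank_pivots => //= j r.
rewrite -leqNgt => le_mb; rewrite BE //.
move: nm; rewrite negb_and -leqNgt -ltnNge => /orP[le_m0|lt_0m]; last first.
  by rewrite z0 ?mulr0 // (leq_trans lt_0m).
case: pickP => [a /eqP ja|_]; last by rewrite mul0r.
have lt_am : (u a < m)%N by rewrite -ja /=.
by rewrite e0 ?mulr0 ?mul0r // (leq_trans lt_am).
Qed.

End SwappedTableau.
End TwoVarieties.

(** * The intersection of two varieties *)

Lemma det_delta_neq0 (F : fieldType) k (A : 'M[F]_k) :
  (forall r s, A r s = (r == s)%:R) -> \det A != 0.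
Proof.
move=> A1; have -> : A = 1%:M by apply/matrixP => r s; rewrite A1 mxE.
by rewrite det1 oner_eq0.
Qed.

Section Matching.
Variables (F : numFieldType) (n p k : nat) (u : 'I_p -> 'I_n) (b : 'I_k -> 'I_n).
Hypotheses (u_inj : injective u) (b_inj : injective b).
Hypothesis (ub : forall m r, u m != b r).
Hypothesis (cover : forall j, (exists m, j = u m) \/ (exists r, j = b r)).
Variables (T T' : two_column) (rho : 'I_k -> 'I_p) (s0 : 'I_k) (a0 : 'I_p).
Hypotheses (rho_inj : injective rho) (rho_lt : forall r, (u (rho r) < b r)%N).
Local Notation m0 := (rho s0).
Hypothesis cT : forall m, (m <= n)%N ->
  count (fun j => j <= m)%N T.2 = #|[pred r | b r < m]%N|.
Hypothesis cT' : forall m, (m <= n)%N ->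
  count (fun j => j <= m)%N T'.2 = #|[pred r | b_swap u b s0 m0 r < m]%N|.

Definition inner r := (u m0 < b r < b s0)%N.

(** The first-column entries strictly between i_s and b_s are the left ends of the nested arcs: arcs
    do not cross, and the greedy choice leaves no free entry under an arc. *)
Hypothesis rho_onto_inner :
  forall m, (u m0 < u m < b s0)%N -> exists2 r, rho r = m & inner r.
Hypothesis rho_inner : forall r, inner r -> (u m0 < u (rho r))%N.
Hypothesis lt_a0 : (u a0 < u m0)%N.
Hypothesis a0_free : forall r, rho r = a0 -> (b s0 < b r)%N.

Local Notation X := (square_zero u b).
Implicit Types (A M : 'M[F]_(p, k)) (L : 'M[F]_(k, p)).

Let lt_m0 : (u m0 < b s0)%N := rho_lt s0.

(** Each position satisfies exactly one of [b r < u m] and [u m < b r], so one matrix carries the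
    transpose of L and M without overlap. *)
Definition lower_part A : 'M[F]_(k, p) :=
  \matrix_(r, m) if (b r < u m)%N then A m r else 0.
Definition upper_part A : 'M[F]_(p, k) :=
  \matrix_(m, r) if (u m < b r)%N then A m r else 0.

Definition param A := X (lower_part A) (upper_part A).

Lemma upper_lower_part A : upper_bu u b (lower_part A).
Proof. by move=> r m le_ub; rewrite mxE ltnNge le_ub. Qed.

Lemma upper_upper_part A : upper_ub u b (upper_part A).
Proof. by move=> m r le_bu; rewrite mxE ltnNge le_bu. Qed.

Let algA := polyfun_algebra F p k.

Lemma lower_part_alg : alg_mx (@polyfun F p k) lower_part.
Proof.
move=> r m; have -> : (fun A => lower_part A r m) =
    fun A => if (b r < u m)%N then A m r else 0.
  by apply: funext => A; rewrite mxE.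
by case: (_ < _)%N; [exact: polyfun_coord|exact: alg_cst].
Qed.

Lemma upper_part_alg : alg_mx (@polyfun F p k) upper_part.
Proof.
move=> m r; have -> : (fun A => upper_part A m r) =
    fun A => if (u m < b r)%N then A m r else 0.
  by apply: funext => A; rewrite mxE.
by case: (_ < _)%N; [exact: polyfun_coord|exact: alg_cst].
Qed.

Lemma square_zero_alg D (C : (D -> F) -> Prop) (Lf : D -> 'M[F]_(k, p)) Mf :
  function_algebra C -> alg_mx C Lf -> alg_mx C Mf ->
  alg_mx C (fun x => X (Lf x) (Mf x)).
Proof.
move=> algC CL CM.
have cst q r (B : 'M[F]_(q, r)) : alg_mx C (fun=> B) by exact: alg_mx_cst.
apply: (alg_mxM algC); last first.
  by apply: (alg_mxD algC) => //; apply: (alg_mxM algC).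
apply: (alg_mxM algC) => //; apply: (alg_mxD algC) => //.
by apply: (alg_mxN algC); apply: (alg_mxM algC).
Qed.

Lemma rowsub_alg D (C : (D -> F) -> Prop) q r l (f : 'I_l -> 'I_q)
    (g : D -> 'M[F]_(q, r)) :
  alg_mx C g -> alg_mx C (fun x => rowsub f (g x)).
Proof.
move=> Cg i j; have -> : (fun x => rowsub f (g x) i j) = fun x => g x (f i) j.
  by apply: funext => x; rewrite mxE.
exact: Cg.
Qed.

Lemma param_alg : alg_mx (@polyfun F p k) param.
Proof.
by apply: square_zero_alg; [exact: algA|exact: lower_part_alg|exact: upper_part_alg].
Qed.

Lemma generic_param x : generic_part F n k T x -> range param x.
Proof.
move/(generic_square_zero u_inj b_inj ub cover cT) => [L [M [-> _ M0 L0]]].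
exists (M + L^T) => //; congr X.
  apply/matrixP => r m; rewrite !mxE; case: ltnP => [lt_bu|]; last by move/L0.
  by rewrite M0 ?add0r // ltnW.
apply/matrixP => m r; rewrite !mxE; case: ltnP => [lt_ub|]; last by move/M0.
by rewrite L0 ?addr0 // ltnW.
Qed.

(** With [L = 0] and [f = rho] the resulting square-zero matrix has its ones exactly at the arcs of
    [rho]. *)
Definition match_mx (f : 'I_k -> 'I_p) : 'M[F]_(p, k) :=
  \matrix_(m, r) (m == f r)%:R.

Lemma det_match_mx f : injective f -> \det (rowsub f (match_mx f)) != 0.
Proof. by move=> f_inj; apply: det_delta_neq0 => r s; rewrite !mxE inj_eq. Qed.

(** The parameters with nonzero minor of M on [rho] form a nonempty open set mapped into the generic
    part, and the closure of its image is the closure of the whole generic part. *)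
Lemma orbital_variety_irreducible : irreducible (orbital_variety F n k T).
Proof.
pose d A := \det (rowsub rho (upper_part A)).
have pd : polyfun d.
  by apply: (alg_det algA); apply: rowsub_alg; exact: upper_part_alg.
have d0 : d (match_mx rho) != 0.
  suff -> : d (match_mx rho) =
    \det (rowsub rho (match_mx rho)) by exact: det_match_mx.
  congr (\det _); apply/matrixP => r s; rewrite !mxE (inj_eq rho_inj).
  by case: eqVneq => [->|]; rewrite ?rho_lt ?if_same.
have genP A : d A != 0 -> generic_part F n k T (param A).
  move=> /rank_unit_rowsub rkM; apply: square_zero_in_generic => //.
    exact: upper_lower_part.
  exact: upper_upper_part.
have := irreducible_image param_alg pd d0 (fun A dA => (genP A dA).1).
congr (irreducible (_ `&` _)); apply/seteqP; split.
  apply: zariski_closure_min; first exact: zariski_closure_closed.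
  by move=> _ [A dA <-]; apply: sub_zariski_closure; exact: genP.
(* A generic point may have a vanishing minor on [rho]; density of [d A != 0] among the parameters
   covers it. *)
apply: zariski_closure_min; first exact: zariski_closure_closed.
move=> _ /generic_param[A _ <-]; apply/zariski_closureP => f pf f0.
have pfp := polyfun_comp algA pf param_alg.
apply/eqP/negPn/negP => fA.
have [B] := polyfun_mul_nonzero pd pfp d0 fA.
rewrite mulf_eq0 negb_or => /andP[dB /eqP[]]; apply: f0; by exists B.
Qed.

Lemma orbital_variety_chain_bound e C :
  irreducible_chain (orbital_variety F n k T) e C -> (e <= p * k)%N.
Proof.
apply: (chain_length_bound param_alg) => x [Tx _].
apply: zariski_closure_min Tx; first exact: zariski_closure_closed.
by move=> y /generic_param; exact: sub_zariski_closure.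
Qed.

Definition inner_or r := inner r || (r == s0).

(* The minor on the arcs of rho lying in [i_s, b_s] vanishes on V_T', not on V_T. *)
Definition arc_minor (x : 'M[F]_n) : F :=
  \det (\matrix_(r, s) if inner_or r && inner_or s
                      then x (u (rho r)) (b s) else (r == s)%:R).

Lemma arc_minor_poly : polyfun arc_minor.
Proof.
apply: (alg_det (polyfun_algebra F n n)) => r s.
have -> : (fun x : 'M[F]_n => (\matrix_(r, s) if inner_or r && inner_or s
      then x (u (rho r)) (b s) else (r == s)%:R) r s)
    = fun x => if inner_or r &&
      inner_or s then x (u (rho r)) (b s) else (r == s)%:R.
  by apply: funext => x; rewrite mxE.
case: (_ && _); first exact: polyfun_coord.
exact: alg_cst (polyfun_algebra F n n) _.
Qed.

Lemma inner_or_ge r : inner_or r -> (u m0 <= u (rho r))%N.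
Proof. by case/orP => [/rho_inner/ltnW|/eqP ->]. Qed.

(** For [T'] column b_s is no longer a pivot, hence a combination of earlier pivot columns. In the
    rows of the minor only the inner ones contribute, so its columns are dependent; [w] records the
    dependency. *)
Lemma arc_minor_eq0 x : generic_part F n k T' x -> arc_minor x = 0.
Proof.
move=> [[_ upx] rkx].
have [|V [xV _ V0]] :=
    @echelon_factor F n k _ x (b_swap_inj b_inj ub (s0 := s0) (m0 := m0)).
  by move=> m le_mn; rewrite -rank_upper_left // rkx cT'.
pose w : 'cV[F]_k := \col_s (if s == s0 then 1 else if inner s then - V s (b s0) else 0).
apply/eqP; rewrite /arc_minor -det_tr; apply/det0P; exists w^T.
  by apply/rV0Pn; exists s0; rewrite !mxE eqxx oner_eq0.
apply/rowP => r; rewrite !mxE; under eq_bigr do rewrite !mxE.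
rewrite (bigD1 s0) //= eqxx mul1r.
have Js0 : inner_or s0 by rewrite /inner_or eqxx orbT.
case Jr: (inner_or r); last first.
  rewrite /= (_ : (r == s0) = false); last first.
    by apply: contraFF Jr => /eqP ->.
  rewrite add0r big1 // => s /negPf ss0; rewrite ss0 /=.
  case: ifP => [Is|]; last by rewrite mul0r.
  case: eqVneq => [rs|]; last by rewrite mulr0.
  by rewrite rs /inner_or Is in Jr.
have -> : x (u (rho r)) (b s0) =
    \sum_(s | s != s0) if inner s then x (u (rho r)) (b s) * V s (b s0) else 0.
  have := congr1 (fun y : 'M[F]_n => y (u (rho r)) (b s0)) xV.
  (* The pivot of index [s0] is now column [u m0], zero in these rows by triangularity. Pivots
     before it vanish there too, and pivots after [b s0] have coefficient zero. *)
  rewrite mxE (bigD1 s0) //= => ->; rewrite mxE {1}/b_swap eqxx.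
  rewrite upx ?inner_or_ge // mul0r add0r; apply: eq_bigr => s ss0.
  have bs : b_swap u b s0 m0 s = b s by rewrite /b_swap (negPf ss0).
  rewrite mxE bs; case: ifPn => //; rewrite negb_and -!leqNgt => /orP[le_s|le_s].
    by rewrite upx ?mul0r // (leq_trans le_s) ?inner_or_ge.
  rewrite V0 ?mulr0 // bs ltn_neqAle le_s andbT.
  by apply: contra ss0 => /eqP/val_inj/b_inj ->.
rewrite Js0 -big_split big1 //= => s /negPf ss0; rewrite ss0 /inner_or ss0 orbF.
by case: ifP => Is; rewrite ?mulNr ?mul0r ?addr0 // mulrC subrr.
Qed.

Lemma arc_minor_match : arc_minor (X 0 (match_mx rho)) != 0.
Proof.
apply: det_delta_neq0 => r s; rewrite mxE; case: ifP => // _.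
by rewrite square_zero_ub // mxE (inj_eq rho_inj).
Qed.

Lemma generic_match : generic_part F n k T (X 0 (match_mx rho)).
Proof.
apply: square_zero_in_generic => //.
- by move=> r m _; rewrite mxE.
- move=> m r le_bu; rewrite mxE; case: eqVneq => // mr.
  by have := rho_lt r; rewrite -mr ltnNge le_bu.
- by apply: (rank_unit_rowsub (f := rho)); exact: det_match_mx.
Qed.

Lemma orbital_variety_not_sub :
  ~ orbital_variety F n k T `<=`
    orbital_variety F n k T `&` orbital_variety F n k T'.
Proof.
move=> sub; have [|_ [/zariski_closureP H _]] := sub (X 0 (match_mx rho)).
  by split; [apply: sub_zariski_closure|]; have [] := generic_match.
have := arc_minor_match; rewrite H ?eqxx //; first exact: arc_minor_poly.
exact: arc_minor_eq0.
Qed.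

(* Crossing the arcs at a0 and m0 gives a base point of the intersection. *)
Definition bump_rho r := tperm a0 m0 (rho r).

Lemma bump_rho_inj : injective bump_rho.
Proof. by move=> r s /perm_inj/rho_inj. Qed.

Lemma bump_rho_s0 : bump_rho s0 = a0.
Proof. by rewrite /bump_rho tpermR. Qed.

Lemma bump_rho_inner r : inner r -> bump_rho r = rho r.
Proof.
move=> Ir; rewrite /bump_rho tpermD //.
  by apply: contraTneq (rho_inner Ir) => <-; rewrite -leqNgt ltnW.
by apply: contraTneq (rho_inner Ir) => <-; rewrite ltnn.
Qed.

(** The arc starting at [a0], if there is one, ends beyond [b s0] by [a0_free], so it may start at
    [m0] instead. *)
Lemma bump_rho_lt r : (u (bump_rho r) < b r)%N.
Proof.
rewrite /bump_rho; case: tpermP => [/a0_free|/rho_inj ->|_ _]; last exact: rho_lt.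
  exact: ltn_trans.
exact: ltn_trans lt_a0 _.
Qed.

Definition in_arc (m : 'I_p) := (u m0 <= u m < b s0)%N.

(* Rows of column s0 between i_s and b_s become combinations, with coefficients
   A (rho r) s0, of the columns of the arcs nested inside (i_s, b_s); the entry
   A m0 s0 is not used. *)
Definition tangent_part A : 'M[F]_(p, k) :=
  \matrix_(m, r) if (r == s0) && in_arc m
    then \sum_s upper_part A m s * (if inner s then A (rho s) s0 else 0)
    else upper_part A m r.

Definition tangent_param A := X (lower_part A) (tangent_part A).

(** When this is nonzero, the rows of the inner arcs can cancel any prescribed entries in the inner
    columns; this is how [eta] is found. *)
Definition inner_minor A : F :=
  \det (\matrix_(r, s) if inner r && inner s then upper_part A (rho r) s
                       else (r == s)%:R).

Definition tangent_disc A :=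
  \det (rowsub bump_rho (tangent_part A)) * inner_minor A.

Lemma tangent_part_alg : alg_mx (@polyfun F p k) tangent_part.
Proof.
move=> m r; have -> : (fun A => tangent_part A m r) =
    fun A => if (r == s0) && in_arc m
      then \sum_s upper_part A m s * (if inner s then A (rho s) s0 else 0)
      else upper_part A m r.
  by apply: funext => A; rewrite mxE.
case: (_ && _); last exact: upper_part_alg.
apply: (alg_sum algA) => s; apply: (algM algA); first exact: upper_part_alg.
by case: (inner s); [exact: polyfun_coord|exact: alg_cst].
Qed.

Lemma tangent_param_alg : alg_mx (@polyfun F p k) tangent_param.
Proof.
by apply: square_zero_alg; [exact: algA|exact: lower_part_alg|exact: tangent_part_alg].
Qed.

Lemma tangent_disc_poly : polyfun tangent_disc.
Proof.
apply: (algM algA); first by apply: (alg_det algA); apply: rowsub_alg;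
  exact: tangent_part_alg.
apply: (alg_det algA) => r s.
have -> : (fun A => (\matrix_(r, s) if inner r &&
  inner s then upper_part A (rho r) s
      else (r == s)%:R) r s) =
    fun A => if inner r && inner s then upper_part A (rho r) s else (r == s)%:R.
  by apply: funext => A; rewrite mxE.
by case: (_ && _); [exact: upper_part_alg|exact: alg_cst].
Qed.

Lemma upper_tangent_part A : upper_ub u b (tangent_part A).
Proof.
move=> m r le_bu; rewrite mxE; case: ifP => [/andP[/eqP r0 /andP[_]]|_].
  by rewrite ltnNge -r0 le_bu.
exact: upper_upper_part.
Qed.

Lemma in_arc_inner r : inner r -> in_arc (rho r).
Proof.
move=> Ir; rewrite /in_arc ltnW ?rho_inner //=.
by rewrite (ltn_trans (rho_lt r)) //; case/andP: Ir.
Qed.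

Lemma upper_part_match A m r :
  ((u m < b r)%N -> A m r = match_mx bump_rho m r) ->
  upper_part A m r = (m == bump_rho r)%:R.
Proof.
rewrite 2!mxE; case: ifP => [_ -> //|lt_ub _].
by case: eqVneq lt_ub => // ->; rewrite bump_rho_lt.
Qed.

(** Column [s0] of the base point has its only one in row [a0], outside the arc, so all coefficients
    of the combination are zero there. *)
Lemma tangent_part_match A :
  (forall m r, (u m < b r)%N -> A m r = match_mx bump_rho m r) ->
  tangent_part A = match_mx bump_rho.
Proof.
move=> eqA; have upE m r : upper_part A m r = (m == bump_rho r)%:R.
  exact/upper_part_match/eqA.
apply/matrixP => m r; rewrite [LHS]mxE [RHS]mxE.
case: ifP => [/andP[/eqP -> in_m]|_]; last exact: upE.
rewrite big1 => [|s _].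
  case: eqVneq in_m => // ->; rewrite bump_rho_s0 /in_arc.
  by rewrite leqNgt lt_a0.
case: ifP => Is; last by rewrite mulr0.
rewrite eqA ?mxE ?bump_rho_s0; last first.
  by have /andP[] := in_arc_inner Is.
case: eqVneq => [e|]; last by rewrite mulr0.
by have := rho_inner Is; rewrite e ltnNge ltnW.
Qed.

Lemma tangent_disc_match : tangent_disc (match_mx bump_rho) != 0.
Proof.
apply: mulf_neq0.
  by rewrite tangent_part_match //; apply: det_match_mx; exact: bump_rho_inj.
apply: det_delta_neq0 => r s; rewrite mxE; case: ifP => // /andP[Ir Is].
by rewrite upper_part_match // bump_rho_inner // (inj_eq rho_inj).
Qed.

Let inner_s0 : inner s0 = false.
Proof. by rewrite /inner ltnn andbF. Qed.

Lemma tangent_column A m : in_arc m ->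
  tangent_part A m s0 =
  \sum_s upper_part A m s * (if inner s then A (rho s) s0 else 0).
Proof. by move=> in_m; rewrite mxE eqxx in_m. Qed.

Lemma tangent_part_neq A m r : r != s0 -> tangent_part A m r = upper_part A m r.
Proof. by move=> /negPf rs0; rewrite mxE rs0. Qed.

Lemma tangent_param_in A : tangent_disc A != 0 ->
  (orbital_variety F n k T `&` orbital_variety F n k T') (tangent_param A).
Proof.
rewrite mulf_eq0 negb_or => /andP[/rank_unit_rowsub rkM].
rewrite /inner_minor; set E := \matrix_(r, s) _ => detE.
set M := tangent_part A; set L := lower_part A.
have upL : upper_bu u b L := @upper_lower_part A.
have upM : upper_ub u b M := @upper_tangent_part A.
have GX : generic_part F n k T (X L M) by exact: square_zero_in_generic.
have OX := GX.1; split; first by split=> //; exact: sub_zariski_closure.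
split=> //; clear GX OX.
(* [zeta] is the relation built into [tangent_part]; with triangularity it makes [M *m zeta] vanish
   in all rows from [m0] on. *)
pose zeta : 'cV[F]_k :=
  \col_r if r == s0 then 1 else if inner r then - A (rho r) s0 else 0.
(* [eta] is the unit vector at [m0] plus the combination of those at [rho r], [r] inner, for which
   [eta *m M] vanishes in the inner columns; the invertible [E] supplies the coefficients. *)
pose v : 'rV[F]_k := \row_s if inner s then M m0 s else 0.
pose y := - v *m invmx E.
pose y' : 'rV[F]_k := \row_r if inner r then y 0 r else 0.
pose eta : 'rV[F]_p := delta_mx 0 m0 + y' *m rowsub rho 1%:M.
have etaE m : eta 0 m = (m == m0)%:R + \sum_r y' 0 r * (rho r == m)%:R.
  rewrite mxE [X in X + _]mxE eqxx; congr (_ + _); rewrite mxE.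
  by apply: eq_bigr => r _; rewrite [X in _ * X]mxE [X in _ * X]mxE.
have eta_arc m : ~~ in_arc m -> eta 0 m = 0.
  move=> nm; rewrite etaE big1 => [|r _].
    case: eqVneq nm => [->|_ _]; last by rewrite addr0.
    by rewrite /in_arc leqnn lt_m0.
  rewrite mxE; case: ifP => [Ir|_]; last by rewrite mul0r.
  case: eqVneq => [e|]; last by rewrite mulr0.
  by rewrite -e in_arc_inner in nm.
have etaM s : (eta *m M) 0 s = M m0 s + \sum_r y' 0 r * M (rho r) s.
  rewrite mulmxDl -rowE mxE [X in X + _]mxE; congr (_ + _).
  rewrite -mulmxA mul_rowsub_mx mul1mx mxE.
  by apply: eq_bigr => r _; rewrite [X in _ * X]mxE.
have etaM_inner s : inner s -> (eta *m M) 0 s = 0.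
  move=> Is; have ss0 : s != s0 by apply: contraTneq Is => ->; rewrite inner_s0.
  have : (y *m E) 0 s = - M m0 s.
    by rewrite /y mulmxKV ?unitmxE ?unitfE // mxE mxE Is.
  rewrite etaM mxE => H; apply/eqP; rewrite addrC addr_eq0; apply/eqP.
  rewrite -[RHS]H; apply: eq_bigr => r _.
  rewrite [X in X * _ = _]mxE [X in _ = _ * X]mxE Is andbT.
  case: ifP => Ir; first by rewrite /M tangent_part_neq.
  case: eqVneq => [e|_]; last by rewrite mul0r mulr0.
  by rewrite e Is in Ir.
have Mz m : (u m0 <= u m)%N -> (M *m zeta) m 0 = 0.
  move=> le_m; rewrite mxE (bigD1 s0) //= [X in _ * X]mxE eqxx mulr1.
  have [in_m|nin_m] := boolP (in_arc m); last first.
    have le_bm : (b s0 <= u m)%N.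
      by move: nin_m; rewrite /in_arc le_m /= -leqNgt.
    rewrite upM // add0r big1 // => r /negPf rs0; rewrite [X in _ * X]mxE rs0.
    case: ifP => [/andP[_ lt_r]|]; last by rewrite mulr0.
    by rewrite upM ?mul0r // (leq_trans (ltnW lt_r)).
  rewrite /M tangent_column // (bigD1 s0) //= inner_s0 mulr0 add0r.
  rewrite -big_split big1 //= => r rs0.
  rewrite tangent_part_neq // [X in _ + _ * X]mxE (negPf rs0).
  by case: ifP => _; rewrite ?mulr0 ?addr0 // mulrN subrr.
apply: (@square_zero_degenerate _ _ _ _ _ _ u_inj b_inj ub cover s0 m0 lt_m0
  T' cT' L M zeta eta) => //.
- by rewrite mxE eqxx.
- rewrite etaE eqxx big1 ?addr0 // => r _; rewrite mxE.
  case: ifP => [Ir|]; last by rewrite mul0r.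
  case: eqVneq => [e|]; last by rewrite mulr0.
  by have := rho_inner Ir; rewrite e ltnn.
- move=> r lt_r; rewrite mxE; case: eqVneq lt_r => [->|_ lt_r].
    by rewrite ltnn.
  by case: ifP => // /andP[_ /ltn_trans/(_ lt_r)]; rewrite ltnn.
- by move=> m lt_m; apply: eta_arc; rewrite /in_arc leqNgt lt_m.
(* Column [s0] follows from [eta *m M *m zeta = 0], as [zeta] is 1 at [s0] and otherwise supported
   on inner columns, where [eta *m M] vanishes. *)
- move=> s; rewrite leq_eqVlt => /orP[/eqP/val_inj/b_inj ->|lt_s].
    have : (eta *m M *m zeta) 0 0 = 0.
      rewrite -mulmxA mxE big1 // => m _.
      have [/andP[/Mz -> _]|/eta_arc ->] := boolP (in_arc m);
        first by rewrite mulr0.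
      by rewrite mul0r.
    rewrite mxE (bigD1 s0) //= [X in _ * X + _]mxE eqxx mulr1 big1 ?addr0 //.
    move=> r /negPf rs0; rewrite [X in _ * X]mxE rs0.
    by case: ifP => [/etaM_inner ->|]; rewrite ?mul0r ?mulr0.
  have [|le_s] := boolP (inner s); first exact: etaM_inner.
  have {}le_s : (b s <= u m0)%N by move: le_s; rewrite /inner lt_s andbT -leqNgt.
  rewrite etaM upM // add0r big1 // => r _; rewrite mxE.
  case: ifP => [Ir|]; last by rewrite mul0r.
  by rewrite upM ?mulr0 // (leq_trans le_s) // ltnW // rho_inner.
Qed.

(* Entries of level 0 are visible in the matrix while M is a permutation matrix,
   those of level 1 while the columns of the inner arcs are. *)
Definition pos_level (e : 'I_p * 'I_k) : nat :=
  if (b e.2 < u e.1)%N then 0 else if (e.2 == s0) && in_arc e.1 then 1 else 2.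

(** While M is the matrix of [bump_rho], the block M L displays row [s] of L in the row
    [u (bump_rho s)]; entries of M are read in place. *)
Definition pos_coord (e : 'I_p * 'I_k) : 'I_n * 'I_n :=
  if (b e.2 < u e.1)%N then (u (bump_rho e.2), u e.1) else (u e.1, b e.2).

(** The single position left out accounts for the codimension one. *)
Definition free_positions : seq ('I_p * 'I_k) :=
  [seq e <- enum {: 'I_p * 'I_k} | e != (m0, s0)].

Lemma tangent_param_coord e A : e \in free_positions ->
  (forall e', (e' \notin free_positions) || (pos_level e < pos_level e')%N ->
     A e'.1 e'.2 = match_mx bump_rho e'.1 e'.2) ->
  tangent_param A (pos_coord e).1 (pos_coord e).2 = A e.1 e.2.
Proof.
case: e => m s; rewrite mem_filter mem_enum andbT => ne eqA.
rewrite /pos_coord /=; case: ifPn => [lt_bu|le_ub] /=.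
  rewrite square_zero_uu // tangent_part_match.
    rewrite mxE (bigD1 s) //= big1 ?addr0 => [|r /negPf rs].
      by rewrite !mxE eqxx mul1r lt_bu.
    by rewrite mxE eq_sym (inj_eq bump_rho_inj) rs mul0r.
  move=> m' r lt_ub; apply: (eqA (m', r)); apply/orP; right.
  rewrite /pos_level /= lt_bu [(b r < u m')%N]ltnNge (ltnW lt_ub) /=.
  by case: ifP.
rewrite square_zero_ub //.
have lt_ub : (u m < b s)%N.
  move: le_ub; rewrite -leqNgt leq_eqVlt => /orP[/eqP/val_inj/eqP|//].
  by rewrite (negPf (ub _ _)).
have [/andP[/eqP ss0 in_m]|nsm] := boolP ((s == s0) && in_arc m); last first.
  by rewrite mxE (negPf nsm) mxE lt_ub.
(* The position differs from [(m0, s0)], so [m = rho r] with [r] inner. As the inner columns keep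
   their base values, the combination in row [m] reduces to the coefficient [A m s0]. *)
subst s; have [|r mr Ir] := rho_onto_inner (m := m).
  case/andP: in_m => le_m ->; rewrite andbT ltn_neqAle le_m andbT.
  by apply: contra ne => /eqP/val_inj/u_inj ->.
have upE r' : inner r' -> upper_part A m r' = (m == rho r')%:R.
  move=> Ir'; rewrite upper_part_match ?bump_rho_inner // => lt_r'.
  apply: (eqA (m, r')); apply/orP; right.
  have r's0 : (r' == s0) = false.
    by apply: contraTF Ir' => /eqP ->; rewrite inner_s0.
  by rewrite /pos_level /= [(b s0 < u m)%N]ltnNge (ltnW lt_ub)
    [(b r' < u m)%N]ltnNge (ltnW lt_r') eqxx in_m r's0.
rewrite tangent_column // (bigD1 r) //= Ir upE // -mr eqxx mul1r mr big1 ?addr0 //.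
move=> r' r'r; case: ifP => [Ir'|]; last by rewrite mulr0.
by rewrite upE // -mr (inj_eq rho_inj) eq_sym (negPf r'r) mul0r.
Qed.

Lemma size_free_positions : (size free_positions).+1 = (p * k)%N.
Proof.
rewrite size_filter -[RHS](_ : size (enum {: 'I_p * 'I_k}) = _); last first.
  by rewrite -cardE card_prod !card_ord.
rewrite -(count_predC (pred1 (m0, s0))) count_uniq_mem ?enum_uniq //.
by rewrite mem_enum.
Qed.

Theorem matching_codim_one :
  has_codim (orbital_variety F n k T)
    (orbital_variety F n k T `&` orbital_variety F n k T') 1.
Proof.
apply: (@codim_one F n _ _ (zariski_closure (generic_part F n k T'))
  (size free_positions)).
- exact: orbital_variety_irreducible.
- exact: zariski_closure_closed.
- apply/seteqP; split=> x [TX TX']; first by split=> //; case: TX'.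
  by split=> //; split=> //; case: TX.
- exact: orbital_variety_not_sub.
- by rewrite size_free_positions; exact: orbital_variety_chain_bound.
apply: (coordinate_chain tangent_param_alg tangent_disc_poly tangent_disc_match
  tangent_param_in (level := pos_level) (coord := pos_coord)).
  by rewrite filter_uniq // enum_uniq.
by move=> e A; exact: tangent_param_coord.
Qed.

End Matching.

(** * Young tableaux *)

Section Tableaux.
Local Open Scope nat_scope.

Lemma greedy_max (A : seq nat) b : has (fun d => d < b) A ->
  let i := \max_(d <- A | d < b) d in
  [/\ i \in A, i < b & forall d, d \in A -> d < b -> d <= i].
Proof.
move=> hA i; suff [iA ib] : i \in A /\ i < b.
  by split=> // d dA db; apply: (@leq_bigmax_seq _ A (fun d => d < b) id).
rewrite {}/i; elim: A hA => [//|a A IH] /=.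
rewrite big_cons; case: ifPn => [lt_ab _|_ /= /IH[iA ib]];
  last by rewrite inE iA orbT.
have [/IH[iA ib]|/hasPn nA] := boolP (has (fun d => d < b) A).
  by rewrite /maxn; case: ifP => _; rewrite inE ?iA ?eqxx ?orbT.
by rewrite big_seq_cond big1 ?maxn0 ?mem_head // => d /andP[/nA/negPf ->].
Qed.

Lemma greedy_pairs2 A bs r :
  r < size bs -> (nth (0, 0) (greedy_pairs A bs) r).2 = nth 0 bs r.
Proof. by elim: bs A r => //= b bs IH A [|r] //=; apply: IH. Qed.

Definition greedy_partner A bs r := (nth (0, 0) (greedy_pairs A bs) r).1.

(** The counting hypothesis makes each maximum range over a nonempty set, and the tail inherits it
    because removing [i < b] lowers each count by one. The third conclusion says that arcs do not
    cross, the fourth that entries under an arc were taken earlier. *)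
Lemma greedy_partnerP A bs : uniq A -> sorted ltn bs ->
  (forall r, r < size bs -> r < count (fun d => d < nth 0 bs r) A) ->
  let g := greedy_partner A bs in
  [/\ forall r, r < size bs -> g r \in A /\ g r < nth 0 bs r,
      forall r s, r < s < size bs -> g r <> g s,
      forall r s, r < s < size bs -> g s < nth 0 bs r -> g s < g r
    & forall s d, s < size bs -> d \in A -> g s < d < nth 0 bs s ->
        exists2 r, r < s & g r = d].
Proof.
elim: bs A => [|b bs IH] A uA sb cA g; first by split=> // r s /andP[].
have hA : has (fun d => d < b) A by rewrite has_count (cA 0).
have [iA ib imax] := greedy_max hA;
  set i := (\max_(d <- A | d < b) d) in iA ib imax *.
have lt_b r : r < size bs -> b < nth 0 bs r.
  by move: sb; rewrite /= (path_sortedE ltn_trans) => /andP[/(all_nthP 0) + _];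
    apply.
have [||r lt_r|in' inj' nest' cov'] := IH (rem i A).
- exact: rem_uniq.
- exact: path_sorted sb.
- have := cA r.+1 lt_r; rewrite /= (seq.permP (perm_to_rem iA)) /=.
  by rewrite (ltn_trans ib (lt_b _ lt_r)).
have gS r : g r.+1 = greedy_partner (rem i A) bs r by [].
have g0 : g 0 = i by [].
have gSA r : r < size bs -> g r.+1 \in A /\ g r.+1 != i.
  by move=> /in'[]; rewrite -gS mem_rem_uniq // inE => /andP[-> ->].
split.
- by move=> [_|r /= lt_r]; [|have [? _] := gSA _ lt_r; have [_] := in' _ lt_r].
- move=> [|r] [|s] //= lt_rs; last by rewrite !gS; apply: inj'.
  by rewrite g0 => e; have [_ /eqP[]] := gSA _ lt_rs.
- move=> [|r] [|s] //= lt_rs; last by rewrite !gS; apply: nest'.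
  rewrite g0 => lt_gb; have [gA gi] := gSA _ lt_rs.
  by rewrite ltn_neqAle gi imax.
- move=> [|s] d lt_s dA /andP[lt_gd lt_db].
    by move: lt_gd; rewrite g0 ltnNge imax.
  have [->|di] := eqVneq d i; first by exists 0.
  have [||r lt_rs <-] := cov' s d lt_s; last by exists r.+1.
    by rewrite mem_rem_uniq // inE di.
  by rewrite -gS lt_gd.
Qed.

Lemma count_nth (P : pred nat) t k : size t = k ->
  count P t = #|[pred r : 'I_k | P (nth 0 t r)]|.
Proof.
move=> <-; rewrite -{1}(mkseq_nth 0 t) /mkseq count_map -val_enum_ord count_map enumT.
by rewrite cardE /enum_mem size_filter; apply: eq_count.
Qed.

(** Pigeonhole: were the inequality false, [f] would inject the first [r.+1] entries of [s2] into
    the first [r] entries of [s1]. *)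
Lemma rows_increase (s1 s2 : seq nat) (f : nat -> nat) r :
  sorted ltn s1 -> sorted ltn s2 -> {in s2 &, injective f} ->
  (forall y, y \in s2 -> f y \in s1 /\ f y < y) ->
  r < size s2 -> nth 0 s1 r < nth 0 s2 r.
Proof.
move=> ss1 ss2 f_inj fs lt_r; rewrite ltnNge; apply/negP => le_r.
have us2 : uniq s2 by move: ss2; rewrite ltn_sorted_uniq_leq => /andP[].
have : size (map f (take r.+1 s2)) <= size (take r s1).
  apply: uniq_leq_size.
    rewrite map_inj_in_uniq ?take_uniq // => x y /mem_take xs /mem_take ys.
    exact: f_inj.
  move=> _ /mapP[y ys ->]; have [fy1 fy] := fs _ (mem_take ys).
  rewrite in_take // ltnNge; apply/negP => le_ri.
  move: fy; rewrite ltnNge => /negP[].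
  have le_y : y <= nth 0 s2 r.
    case/(nthP 0): ys => j; rewrite size_takel // => lt_j <-.
    rewrite nth_take //; apply: (sorted_leq_nth leq_trans leqnn) => //.
      by move: ss2; rewrite ltn_sorted_uniq_leq => /andP[].
    by rewrite inE (leq_trans lt_j).
  rewrite (leq_trans le_y) // (leq_trans le_r) // -[leqRHS](nth_index 0 fy1).
  apply: (sorted_leq_nth leq_trans leqnn) => //.
  - by move: ss1; rewrite ltn_sorted_uniq_leq => /andP[].
  - by rewrite inE (leq_ltn_trans le_ri) // index_mem.
  - by rewrite inE index_mem.
by rewrite size_map size_takel // size_take_min leq_min ltnn.
Qed.

(** * Arcs of a Young tableau and its change along one arc *)

Section YoungTableau.
Variables (n k : nat) (T : two_column).
Hypothesis tabT : young_tableau n k T.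

Lemma tableauP :
  [/\ k <= n - k, size T.1 = n - k, size T.2 =
    k & perm_eq (T.1 ++ T.2) (iota 1 n)] /\
  [/\ sorted ltn T.1, sorted ltn T.2
    & forall r, r < k -> nth 0 T.1 r < nth 0 T.2 r].
Proof.
case/and5P: tabT => le_k /eqP s1 /eqP s2 pT /and3P[ss1 ss2 /allP rT].
by split; split=> // r lt_r; apply: (rT r); rewrite mem_iota.
Qed.

Let le_k : k <= n - k. Proof. by case: tableauP => -[]. Qed.
Let size1 : size T.1 = n - k. Proof. by case: tableauP => -[]. Qed.
Let size2 : size T.2 = k. Proof. by case: tableauP => -[]. Qed.
Let permT : perm_eq (T.1 ++ T.2) (iota 1 n). Proof. by case: tableauP => -[]. Qed.
Let sorted1 : sorted ltn T.1. Proof. by case: tableauP => _ []. Qed.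
Let sorted2 : sorted ltn T.2. Proof. by case: tableauP => _ []. Qed.

Let uniqT : uniq (T.1 ++ T.2).
Proof. by rewrite (perm_uniq permT) iota_uniq. Qed.

Let uniq1 : uniq T.1. Proof. by move: uniqT; rewrite cat_uniq => /and3P[]. Qed.
Let uniq2 : uniq T.2. Proof. by move: uniqT; rewrite cat_uniq => /and3P[]. Qed.

Let disjT x : x \in T.1 -> x \in T.2 -> False.
Proof.
move: uniqT; rewrite cat_uniq => /and3P[_ /hasPn dT _] x1 /dT.
by rewrite /= x1.
Qed.

Let memT x : (x \in T.1) || (x \in T.2) = (0 < x <= n).
Proof. by rewrite -mem_cat (perm_mem permT) mem_iota add1n ltnS. Qed.

Let nth2_mono r s : r < k -> s < k -> (nth 0 T.2 r < nth 0 T.2 s) = (r < s).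
Proof.
move=> lt_r lt_s; have mono x y : x < y -> y < k -> nth 0 T.2 x < nth 0 T.2 y.
  move=> xy lt_y; apply: (sorted_ltn_nth ltn_trans) => //; rewrite inE size2 //.
  exact: ltn_trans lt_y.
case: (ltngtP r s) => [rs|sr|->]; last by rewrite ltnn.
  exact: mono.
by apply/negbTE; rewrite -leqNgt ltnW // mono.
Qed.

Lemma tableau_count r : r < size T.2 -> r < count (fun d => d < nth 0 T.2 r) T.1.
Proof.
rewrite size2 => lt_r; rewrite -size_filter.
have lt_r1 : r < size T.1 by rewrite size1 (leq_trans lt_r).
rewrite -(size_takel (n0 := r.+1) (s := T.1)) //; apply: uniq_leq_size.
  exact: take_uniq.
move=> x xt; rewrite mem_filter (mem_take xt) andbT.
have [_ [_ _ /(_ _ lt_r)]] := tableauP; apply: leq_ltn_trans.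
case/(nthP 0): xt => j; rewrite size_takel // => lt_j <-.
rewrite nth_take //; apply: (sorted_leq_nth leq_trans leqnn) => //.
  by move: sorted1; rewrite ltn_sorted_uniq_leq => /andP[].
by rewrite inE (leq_trans lt_j).
Qed.

Local Notation g := (greedy_partner T.1 T.2).

Lemma tableau_greedy :
  [/\ forall r, r < k -> g r \in T.1 /\ g r < nth 0 T.2 r,
      forall r s, r < k -> s < k -> g r = g s -> r = s,
      forall r s, r < s < k -> g s < nth 0 T.2 r -> g s < g r
    & forall s d, s < k -> d \in T.1 -> g s < d < nth 0 T.2 s ->
        exists2 r, r < s & g r = d].
Proof.
have [] := greedy_partnerP uniq1 sorted2 tableau_count; rewrite size2.
move=> gA g_inj g_nest g_cov; split=> // r s lt_r lt_s e.
have [rs|sr|//] := ltngtP r s.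
  by case: (g_inj r s); rewrite ?rs.
by case: (g_inj s r); rewrite ?sr.
Qed.

(** All second-column entries are at least b_1, so b_1 - 1 lies in the first column and is the
    greedy choice for b_1. *)
Lemma sigma_cyclesE : sigma_cycles T = greedy_pairs T.1 T.2.
Proof.
rewrite /sigma_cycles; case eqT2: T.2 => [//|b bs] /=.
suff -> : \max_(d <- T.1 | d < b) d = b.-1 by [].
have b2 : b \in T.2 by rewrite eqT2 mem_head.
have k0 : 0 < k by rewrite -size2 eqT2.
have [[g0 gb] _ _ _] : [/\ g 0 \in T.1 /\ g 0 < b, True, True & True].
  by have [/(_ 0 k0) + _ _ _] := tableau_greedy; rewrite eqT2.
have : has (fun d => d < b) T.1 by apply/hasP; exists (g 0).
move/greedy_max => /=; set i := \max_(_ <- _ | _) _ => -[i1 ib imax].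
have i0 : 0 < i by have := memT i; rewrite i1 /= => /esym/andP[].
have bn : b <= n by have := memT b; rewrite b2 orbT => /esym/andP[].
suff ge : b.-1 <= i by move: ib ge; clear; lia.
apply: imax; last by move: ib; clear; lia.
have : (b.-1 \in T.1) || (b.-1 \in T.2) by rewrite memT; move: i0 ib bn; clear; lia.
case/orP => // bm; suff : b <= b.-1 by move: ib; clear; lia.
case/(nthP 0): bm => j; rewrite size2 => lt_j <-.
have -> : b = nth 0 T.2 0 by rewrite eqT2.
by rewrite leqNgt nth2_mono.
Qed.

Variable q : nat.
Hypothesis lt_q : q < k.
Local Notation c := (nth 0 T.2 q).
Local Notation i := (g q).
Hypothesis lt_c : 2 * q.+1 < c.

Let c2 : c \in T.2. Proof. by apply: mem_nth; rewrite size2. Qed.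
Let i1 : i \in T.1. Proof. by have [/(_ q lt_q)[]] := tableau_greedy. Qed.
Let lt_ic : i < c. Proof. by have [/(_ q lt_q)[]] := tableau_greedy. Qed.

(** Otherwise every first-column entry below [c] would be the partner of one of the first [q.+1]
    entries of the second column. With the at most [q] second-column entries below [c] this gives
    [c.-1 <= 2 * q + 1], against [lt_c]. *)
Lemma tableau_free_entry : exists a, [/\ a \in T.1, a < i
  & forall r, r < k -> g r = a -> c < nth 0 T.2 r].
Proof.
pose P a := (a < i) && all (fun r => (g r == a) ==> (c < nth 0 T.2 r)) (iota 0 k).
have [/hasP[a a1 /andP[ai /allP ga]]|/hasPn nP] := boolP (has P T.1).
  exists a; split=> // r lt_r gr.
  by have := ga r; rewrite mem_iota /= add0n lt_r gr eqxx => /(_ isT).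
have [_ _ _ g_cov] := tableau_greedy.
have count1 : count (fun d => d < c) T.1 <= q.+1.
  rewrite -size_filter -[leqRHS](size_iota 0) -[leqRHS](size_map g).
  apply: uniq_leq_size; first by rewrite filter_uniq ?uniq1.
  move=> d; rewrite mem_filter => /andP[lt_dc d1].
  have [lt_id|lt_di|<-] := ltngtP i d; last by rewrite map_f // mem_iota /=.
    have [|r lt_r <-] := g_cov q d lt_q d1; first by rewrite lt_id.
    by rewrite map_f // mem_iota /= add0n ltnW.
  have := nP d d1; rewrite /P lt_di andTb => /allPn[r]; rewrite mem_iota => lt_r.
  rewrite negb_imply -leqNgt => /andP[/eqP gr le_rc]; apply/mapP; exists r => //.
  by rewrite mem_iota /= add0n ltnS leqNgt -nth2_mono // -leqNgt.
have count2 : count (fun d => d < c) T.2 <= q.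
  rewrite -size_filter -[leqRHS](size_iota 0) -[leqRHS](size_map (nth 0 T.2)).
  apply: uniq_leq_size; first by rewrite filter_uniq ?uniq2.
  move=> d; rewrite mem_filter => /andP[lt_dc /(nthP 0)[r]];
    rewrite size2 => lt_r dr.
  by rewrite -dr map_f // mem_iota /= add0n -nth2_mono // dr.
have : c.-1 <= count (fun d => d < c) (T.1 ++ T.2).
  rewrite -size_filter -[leqLHS](size_iota 1); apply: uniq_leq_size.
    exact: iota_uniq.
  move=> d; rewrite mem_iota mem_filter mem_cat memT => /andP[d0].
  have := memT c; rewrite c2 orbT => /esym/andP[c0 cn].
  by rewrite add1n prednK // => dc; rewrite dc d0 (leq_trans (ltnW dc)).
by rewrite count_cat; move: lt_c count1 count2; clear; lia.
Qed.

Lemma Change_young_tableau : young_tableau n k (Change T i c).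
Proof.
have [a [a1 ai ga]] := tableau_free_entry.
have [gA g_inj _ _] := tableau_greedy.
have perm1 : perm_eq (Change T i c).1 (c :: rem i T.1) by rewrite perm_sort.
have perm2 : perm_eq (Change T i c).2 (i :: rem c T.2) by rewrite perm_sort.
have permC : perm_eq ((Change T i c).1 ++ (Change T i c).2) (T.1 ++ T.2).
  rewrite (perm_trans (perm_cat perm1 perm2)) // perm_sym.
  rewrite (perm_trans (perm_cat (perm_to_rem i1) (perm_to_rem c2))) //=.
  by apply/seq.permP => P; rewrite /= !count_cat /=; clear; lia.
have := uniqT; rewrite -(perm_uniq permC) cat_uniq => /and3P[uC1 _ uC2].
have sC1 : sorted ltn (Change T i c).1.
  by rewrite ltn_sorted_uniq_leq uC1 sort_sorted //; exact: leq_total.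
have sC2 : sorted ltn (Change T i c).2.
  by rewrite ltn_sorted_uniq_leq uC2 sort_sorted //; exact: leq_total.
have size1' : size (Change T i c).1 = n - k.
  by rewrite (perm_size perm1) -size1 (perm_size (perm_to_rem i1)).
have size2' : size (Change T i c).2 = k.
  by rewrite (perm_size perm2) -[RHS]size2 (perm_size (perm_to_rem c2)).
apply/and5P; split; rewrite ?size1' ?size2' //; first exact: perm_trans permC permT.
apply/and3P; split=> //; apply/allP => r; rewrite mem_iota => lt_r.
(* The new matching: [i] takes the free entry [a], an arc that used [a] takes [c], which is smaller
   than its right end, and the others are kept. *)
pose f y := if y == i then a else
  if g (index y T.2) == a then c else g (index y T.2).
have mem2 y : y \in (Change T i c).2 -> y != i ->
    [/\ index y T.2 < k, index y T.2 != q & nth 0 T.2 (index y T.2) = y].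
  rewrite (perm_mem perm2) inE => /orP[->//|]; rewrite mem_rem_uniq // inE.
  move=> /andP[yc y2] yi; rewrite -size2 index_mem y2 nth_index //; split=> //.
  by apply: contra yc => /eqP e; rewrite -[y](nth_index 0 y2) e.
apply: (rows_increase (f := f)) => //; last by rewrite size2'.
- move=> y y' /mem2 y2 /mem2 y2'; rewrite /f.
  case: eqVneq y2 => [-> _|_ /(_ isT)[lt_y yq ey]];
    case: eqVneq y2' => [-> _|_ /(_ isT)[lt_y' yq' ey']] //.
  + case: ifP => [_ e|/eqP H /esym//].
    by case: (@disjT c) => //; rewrite -e.
  + case: ifP => [_ e|/eqP H //].
    by case: (@disjT c) => //; rewrite e.
  + case: ifP => [/eqP e1|_]; case: ifP => [/eqP e2|_] e.
    * by rewrite -ey -ey' (g_inj (index y T.2) (index y' T.2)) // e1.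
    * by case: (@disjT c) => //; rewrite e; have [] := gA _ lt_y'.
    * by case: (@disjT c) => //; rewrite -e; have [] := gA _ lt_y.
    * by rewrite -ey -ey' (g_inj _ _ lt_y lt_y').
- move=> y /mem2 y2; rewrite (perm_mem perm1) inE mem_rem_uniq // inE /f.
  case: eqVneq y2 => [-> _|_ /(_ isT)[lt_y yq ey]].
    by rewrite a1 andbT (ltn_eqF ai) orbT.
  have [gy1 gyy] := gA _ lt_y; rewrite ey in gyy.
  have [gy|gya] := eqVneq (g (index y T.2)) a.
    by rewrite eqxx -[X in _ < X]ey; split=> //; exact: ga.
  rewrite gy1 andbT; split=> //; apply/orP; right.
  by apply: contra yq => /eqP/g_inj -> //.
Qed.

Lemma count_Change m : count (fun d => d <= m) (Change T i c).2 =
  count (fun d => d <= m) T.2 + (i <= m < c).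
Proof.
have /seq.permP -> : perm_eq (Change T i c).2 (i :: rem c T.2) by rewrite perm_sort.
by rewrite (seq.permP (perm_to_rem c2)) /=; move: lt_ic; clear; lia.
Qed.

Lemma tableau_codim (F : numFieldType) :
  has_codim (orbital_variety F n k T)
    (orbital_variety F n k T `&` orbital_variety F n k (Change T i c)) 1%R.
Proof.
have [gA g_inj g_nest g_cov] := tableau_greedy.
have entry x : (x \in T.1) || (x \in T.2) -> exists j : 'I_n, j.+1 = x.
  rewrite memT => /andP[x0 xn]; have lt_x : x.-1 < n by rewrite prednK.
  by exists (Ordinal lt_x); rewrite /= prednK.
(* Entries of the tableau count from 1 and indices in ['I_n] from 0, so each index is the entry
   minus one. *)
have /fin_all_exists[u uP] (m : 'I_(n - k)) : exists j : 'I_n, j.+1 = nth 0 T.1 m.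
  by apply: entry; rewrite mem_nth // size1.
have /fin_all_exists[b bP] (r : 'I_k) : exists j : 'I_n, j.+1 = nth 0 T.2 r.
  by apply: entry; rewrite orbC mem_nth // size2.
have u1 m : (u m).+1 \in T.1 by rewrite uP mem_nth // size1.
have b2 r : (b r).+1 \in T.2 by rewrite bP mem_nth // size2.
have ent1 d : d \in T.1 -> exists m, (u m).+1 = d.
  by case/(nthP 0) => m; rewrite size1 => lt_m <-; exists (Ordinal lt_m);
    rewrite uP.
have ent2 d : d \in T.2 -> exists r, (b r).+1 = d.
  by case/(nthP 0) => r; rewrite size2 => lt_r <-; exists (Ordinal lt_r);
    rewrite bP.
have u_inj : injective u.
  move=> m m' e; have : nth 0 T.1 m == nth 0 T.1 m' by rewrite -!uP e.
  by rewrite nth_uniq ?size1 ?ltn_ord // => /eqP/val_inj.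
have b_inj : injective b.
  move=> r r' e; have : nth 0 T.2 r == nth 0 T.2 r' by rewrite -!bP e.
  by rewrite nth_uniq ?size2 ?ltn_ord // => /eqP/val_inj.
have ub m r : u m != b r.
  by apply/eqP => e; apply: (@disjT (u m).+1); rewrite // e.
have cover j : (exists m, j = u m) \/ (exists r, j = b r).
  have : (j.+1 \in T.1) || (j.+1 \in T.2) by rewrite memT /=.
  case/orP => [/ent1[m e]|/ent2[r e]]; [left; exists m|right; exists r];
    by apply: val_inj; case: e.
have /fin_all_exists[rho rhoP] (r : 'I_k) : exists m, (u m).+1 = g r.
  by apply: ent1; have [] := gA r (ltn_ord r).
have rho_inj : injective rho.
  move=> r r' e; apply/val_inj/(g_inj _ _ (ltn_ord r) (ltn_ord r')).
  by rewrite -!rhoP e.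
pose s0 := Ordinal lt_q.
have s0P : (b s0).+1 = c by rewrite bP.
have m0P : (u (rho s0)).+1 = i by rewrite rhoP.
have [a [a1 ai ga]] := tableau_free_entry; have [a0 a0P] := ent1 a a1.
have rho_lt r : u (rho r) < b r.
  by rewrite -ltnS rhoP bP; have [] := gA r (ltn_ord r).
have cT m : (m <= n)%N -> count (fun j => j <= m) T.2 = #|[pred r | b r < m]|.
  move=> _; rewrite (count_nth _ size2); apply: eq_card => r.
  by rewrite !inE -bP.
apply: (@matching_codim_one F n (n - k) k u b u_inj b_inj ub cover _ _ rho s0 a0) => //.
- move=> m le_m; rewrite card_b_swap // -cT // count_Change.
  by rewrite -m0P -s0P ltnS.
- move=> m /andP[lt1 lt2].
  have [||r lt_r gr] := g_cov q (u m).+1 lt_q; first exact: u1.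
    by rewrite -m0P -s0P !ltnS lt1.
  have lt_rk := ltn_trans lt_r lt_q; exists (Ordinal lt_rk).
    by apply: u_inj; apply: val_inj; have := rhoP (Ordinal lt_rk);
      rewrite /= gr => -[].
  have [_ gb] := gA r lt_rk; rewrite /inner; apply/andP; split.
    by rewrite (ltn_trans lt1) // -ltnS -gr bP.
  by rewrite -ltnS !bP nth2_mono.
- move=> r /andP[lt1]; rewrite -ltnS !bP nth2_mono //= => lt_rq.
  by rewrite -ltnS !rhoP; apply: g_nest; rewrite ?lt_rq // -m0P -bP ltnS.
- by rewrite -ltnS a0P m0P.
- by move=> r e; rewrite -ltnS s0P bP; apply: ga; rewrite // -rhoP e a0P.
Qed.

End YoungTableau.

End Tableaux.

Theorem proposition4p4 (R : realType) (n k : nat) (T : two_column)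
    (le_k : (k.*2 <= n)%N) (tabT : young_tableau n k T)
    (s : nat) (s_range : (1 <= s <= k)%N) :
  let i_s := (nth (0, 0)%N (sigma_cycles T) s.-1).1 in
  let b_s := (nth (0, 0)%N (sigma_cycles T) s.-1).2 in
  (2 * s < b_s)%N ->
  let T' := Change T i_s b_s in
  young_tableau n k T' /\
  has_codim (orbital_variety R[i] n k T)
            (orbital_variety R[i] n k T `&` orbital_variety R[i] n k T') 1.
Proof.
move=> i_s b_s lt_b T'.
have [s0 le_sk] := andP s_range.
have lt_q : (s.-1 < k)%N by rewrite prednK.
have [[_ _ size2 _] _] := tableauP tabT.
have eq_b : b_s = nth 0%N T.2 s.-1.
  by rewrite /b_s (sigma_cyclesE tabT) greedy_pairs2 ?size2.
have eq_i : i_s = greedy_partner T.1 T.2 s.-1.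
  by rewrite /i_s (sigma_cyclesE tabT).
have lt_c : (2 * s.-1.+1 < nth 0%N T.2 s.-1)%N by rewrite prednK // -eq_b.
rewrite /T' eq_b eq_i; split; first exact: Change_young_tableau.
exact: tableau_codim.
Qed.
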